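(* Let $A\in\mathbb{R}^{d\times d}$ be symmetric, $b\in\mathbb{R}^d$, $R>0$, $f(x)=\tfrac12x^TAx+b^Tx$, and $x^\star\in\arg\min_{\|x\|\le R}f(x)$. Let $v$ be uniformly distributed on the unit sphere in $\mathbb{R}^d$, let $\sigma>0$, and let $\tilde b=b+\sigma v$. For an integer $t\ge1$ let $\tilde s_t$ be a minimizer of $\tilde f(x)=\tfrac12x^TAx+\tilde b^Tx$ over $\{x\in\mathcal{K}_t(A,\tilde b):\ \|x\|\le R\}$. Then for any $\delta>0$, with probability at least $1-\delta$ with respect to the random choice of $v$, $$f(\tilde s_t)-f(x^\star)\le\frac{(\lambda_{\max}-\lambda_{\min})R^2}{(t-\frac12)^2}\left[4+\frac{\mathbb{1}_{\{\lambda_{\min}<0\}}}{2}\log^2\left(\frac{2\|\tilde b\|\sqrt d}{\sigma\delta}\right)\right]+2\sigma R.$$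
   Context: $\|\cdot\|$ is the Euclidean norm. $\lambda_{\min}\le\lambda_{\max}$ are the smallest and largest eigenvalues of $A$. The Krylov subspace of order $t$ is $\mathcal{K}_t(A,\tilde b)=\mathrm{span}\{\tilde b,A\tilde b,\dots,A^{t-1}\tilde b\}$. $\mathbb{1}_{\{\lambda_{\min}<0\}}$ equals $1$ if $\lambda_{\min}<0$ and $0$ otherwise; if $\lambda_{\min}\ge0$ the logarithmic term is absent. Convention: if $\lambda_{\min}<0$ and $\tilde b=0$, the right-hand side is read as $+\infty$. *)

(* Defs.v *)
(* MathComp / MathComp-Analysis *)
From mathcomp Require Import all_boot all_order all_algebra.
From mathcomp Require Import all_classical all_reals all_analysis.

Set Implicit Arguments.
Unset Strict Implicit.
Unset Printing Implicit Defensive.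

Import Order.TTheory GRing.Theory Num.Theory.
Import numFieldNormedType.Exports.

Local Open Scope classical_set_scope.
Local Open Scope ring_scope.

(* The library norm `|x| on matrices is the sup norm, hence this definition. *)
Definition enorm (R : realType) (d : nat) (x : 'cV[R]_d) : R :=
  Num.sqrt (\sum_(i < d) x i 0 ^+ 2).

Definition quad (R : realType) (d : nat) (A : 'M[R]_d) (b x : 'cV[R]_d) : R :=
  2^-1 * (x^T *m A *m x) 0 0 + (b^T *m x) 0 0.

Definition eball (R : realType) (d : nat) (r : R) : set 'cV[R]_d :=
  [set x | enorm x <= r].

Definition is_argmin (R : realType) (T : Type) (S : set T) (f : T -> R)
    (x : T) : Prop :=
  S x /\ forall y, S y -> f x <= f y.

(* For symmetric A and 0 < d the spectrum is finite and nonempty, so the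
   infimum and supremum below are its least and greatest elements. *)
Definition lambda_min (R : realType) (d : nat) (A : 'M[R]_d) : R :=
  inf [set a : R | eigenvalue A a].

Definition lambda_max (R : realType) (d : nat) (A : 'M[R]_d) : R :=
  sup [set a : R | eigenvalue A a].

Definition krylov (R : realType) (d : nat) (A : 'M[R]_d) (b : 'cV[R]_d)
    (t : nat) : {vspace 'cV[R]_d} :=
  <<mkseq (fun i => A ^+ i *m b) t>>%VS.

Notation borel_cV R d := (g_sigma_algebraType (@open 'cV[R]_d)).

(* The uniform distribution on the unit sphere is the rotation-invariant Borel
   probability measure carried by the sphere, which is unique: existence and
   uniqueness hold for every 0 < d (for d = 1 it is the fair coin on {-1, 1}). *)
Definition uniform_sphere (R : realType) (d : nat)
    (mu : set (borel_cV R d) -> \bar R) : Prop :=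
  mu [set x : 'cV[R]_d | enorm x = 1] = 1%E /\
  forall Q : 'M[R]_d, Q^T *m Q = 1%:M ->
    forall B : set (borel_cV R d), measurable B ->
      mu [set x : 'cV[R]_d | B (Q *m x)] = mu B.

(* bt is the perturbed linear term; +oo replaces the junk value ln 0 = 0 in the
   case where the logarithm of 0 would occur. *)
Definition error_bound (R : realType) (d : nat) (A : 'M[R]_d)
    (bt : 'cV[R]_d) (r sigma delta : R) (t : nat) : \bar R :=
  if (lambda_min A < 0) && (bt == 0) then +oo%E else
  ((lambda_max A - lambda_min A) * r ^+ 2 / (t%:R - 2^-1) ^+ 2
     * (4 + (lambda_min A < 0)%R%:R / 2
            * ln (2 * enorm bt * Num.sqrt d%:R / (sigma * delta)) ^+ 2)
   + 2 * sigma * r)%:E.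

(* Main.v *)
(** Let M = A - lambda_min, D = lambda_max - lambda_min. Projecting onto a centred
    ball is a rescaling, so the iterates of accelerated projected gradient descent
    stay in the Krylov space; this gives, for the convex part of the objective, a
    gap of at most 2 D R^2 / (t+1)^2 against every competitor in the ball. If
    lambda_min < 0, the constraint is made tight by moving along a Krylov vector z
    with a small Rayleigh quotient for M. Such a z comes from a Chebyshev
    polynomial in M: its Rayleigh quotient is at most D (l / (2t - 1))^2 as soon
    as 2 |b~| <= e^l |<u, b~>|, where u is a unit eigenvector for lambda_min.

    The overlap <u, b~> = <u, b> + sigma <u, v> is bounded below by
    anti-concentration of x = <u, v>. Differentiating the rotation invariance of
    the law of v gives the Stein identity E[(d-1) x G(x)] = E[(1 - x^2) G'(x)], and
    a suitable G yields P(|x - c| <= eta) <= 16 eta sqrt d for d >= 3. The constant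
    16 > 1 is absorbed by the slack (2 + (L + ln 16)^2 / 8 <= 4 + L^2 / 2) of the
    two deterministic estimates. For d = 2 the density of x is unbounded, but then
    two steps are exact as soon as <u, b~> != 0, which has probability 1; for
    t = 1 or d = 1 nothing is needed beyond b~ != 0. *)
Require Import Defs.
From mathcomp Require Import all_boot all_order all_algebra.
From mathcomp Require Import all_classical all_reals all_analysis.
From mathcomp Require Import ring lra.

Set Implicit Arguments.
Unset Strict Implicit.
Unset Printing Implicit Defensive.

Import Order.TTheory GRing.Theory Num.Theory.
Import numFieldNormedType.Exports.

Local Open Scope classical_set_scope.
Local Open Scope ring_scope.

(** * Quadratic forms and extreme eigenvalues *)

Definition dot (R : realType) (d : nat) (x y : 'cV[R]_d) : R := (x^T *m y) 0 0.

Section Dot.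
Variables (R : realType) (d : nat).
Implicit Types (x y z u b : 'cV[R]_d) (A M : 'M[R]_d).

Lemma dotE x y : dot x y = \sum_i x i 0 * y i 0.
Proof. by rewrite /dot mxE; apply: eq_bigr => i _; rewrite mxE. Qed.

Lemma dotC x y : dot x y = dot y x.
Proof. by rewrite !dotE; apply: eq_bigr => i _; rewrite mulrC. Qed.

Lemma dotDr x y z : dot x (y + z) = dot x y + dot x z.
Proof. by rewrite /dot mulmxDr mxE. Qed.

Lemma dotDl x y z : dot (x + y) z = dot x z + dot y z.
Proof. by rewrite dotC dotDr !(dotC z). Qed.

Lemma dotZr a x y : dot x (a *: y) = a * dot x y.
Proof. by rewrite /dot -scalemxAr mxE. Qed.

Lemma dotZl a x y : dot (a *: x) y = a * dot x y.
Proof. by rewrite dotC dotZr dotC. Qed.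

Lemma dotNr x y : dot x (- y) = - dot x y.
Proof. by rewrite -scaleN1r dotZr mulN1r. Qed.

Lemma dotNl x y : dot (- x) y = - dot x y.
Proof. by rewrite dotC dotNr dotC. Qed.

Lemma dot0r x : dot x 0 = 0.
Proof. by rewrite -(scale0r (0 : 'cV[R]_d)) dotZr mul0r. Qed.

Lemma dot0l x : dot 0 x = 0.
Proof. by rewrite dotC dot0r. Qed.

Definition dot_lin := (dotDl, dotDr, dotZl, dotZr, dotNl, dotNr, dot0l, dot0r).

Lemma dot_ge0 x : 0 <= dot x x.
Proof. by rewrite dotE; apply: sumr_ge0 => i _; rewrite -expr2 sqr_ge0. Qed.

Lemma dot_eq0 x : (dot x x == 0) = (x == 0).
Proof.
apply/eqP/eqP => [|->]; last by rewrite dot0l.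
rewrite dotE => /eqP; rewrite psumr_eq0 => [/allP xx|i _]; last first.
  by rewrite -expr2 sqr_ge0.
apply/matrixP => i j; rewrite ord1 mxE.
by have := xx i (mem_index_enum i); rewrite -expr2 sqrf_eq0 => /eqP.
Qed.

Lemma dot_gt0 x : (0 < dot x x) = (x != 0).
Proof. by rewrite lt_def dot_ge0 andbT dot_eq0. Qed.

Lemma dot_mx A x y : dot (A *m x) y = dot x (A^T *m y).
Proof. by rewrite /dot trmx_mul mulmxA. Qed.

Lemma dot_sym A x y : A^T = A -> dot (A *m x) y = dot x (A *m y).
Proof. by move=> As; rewrite dot_mx As. Qed.

Lemma enorm_sqrt x : enorm x = Num.sqrt (dot x x).
Proof.
by rewrite /enorm dotE; congr Num.sqrt; apply: eq_bigr => i _; rewrite expr2.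
Qed.

Lemma enorm_ge0 x : 0 <= enorm x.
Proof. exact: sqrtr_ge0. Qed.

Lemma enorm_sqr x : enorm x ^+ 2 = dot x x.
Proof. by rewrite enorm_sqrt sqr_sqrtr// dot_ge0. Qed.

Lemma enorm_le x r : 0 <= r -> (enorm x <= r) = (dot x x <= r ^+ 2).
Proof.
by move=> r0; rewrite -enorm_sqr ler_pXn2r ?nnegrE ?enorm_ge0.
Qed.

Lemma enorm_eq0 x : (enorm x == 0) = (x == 0).
Proof. by rewrite -sqrf_eq0 enorm_sqr dot_eq0. Qed.

Lemma cauchy_schwarz x y : dot x y ^+ 2 <= dot x x * dot y y.
Proof.
have [->|y0] := eqVneq y 0; first by rewrite !dot0r expr0n mulr0.
have yy : 0 < dot y y by rewrite dot_gt0.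
have := dot_ge0 (dot y y *: x - dot x y *: y).
rewrite !dot_lin (dotC y x).
rewrite [leRHS](_ : _ = dot y y * (dot x x * dot y y - dot x y ^+ 2)).
  by rewrite pmulr_rge0// subr_ge0.
by ring.
Qed.

Lemma dot_le_enorm x y : `|dot x y| <= enorm x * enorm y.
Proof.
rewrite -ler_sqr ?nnegrE ?mulr_ge0 ?enorm_ge0//.
by rewrite exprMn !enorm_sqr real_normK ?num_real// cauchy_schwarz.
Qed.

Lemma quadE A b x : quad A b x = 2^-1 * dot x (A *m x) + dot b x.
Proof. by rewrite /quad /dot mulmxA. Qed.

(* If the form vanishes at u, then 0 <= q(u + a y) is linear in a to first
   order for every direction y, in particular for y = B u. *)
Lemma psd_ker A u : A^T = A -> (forall x, 0 <= dot x (A *m x)) ->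
  dot u (A *m u) = 0 -> A *m u = 0.
Proof.
move=> As Apos Au0; set y := A *m u.
pose q := dot y (A *m y); pose n := dot y y.
have q0 : 0 <= q by exact: Apos.
(* The coefficient [n / (q + 1)], in place of the optimal [n / q], also covers [q = 0]; the form
   would be negative there unless [n = 0]. *)
have := Apos (u - (n / (q + 1)) *: y).
rewrite mulmxBr -scalemxAr !dot_lin Au0 -(dot_sym u y As) -/y -/n -/q.
have q1 : 0 < q + 1 by rewrite ltr_pwDr.
rewrite [leRHS](_ : _ = - (n ^+ 2 * ((q + 2) / (q + 1) ^+ 2))); last first.
  by field; rewrite gt_eqF.
rewrite oppr_ge0 pmulr_lle0; last by rewrite divr_gt0 ?exprn_gt0// ltr_wpDl.
by move=> n2; apply/eqP; rewrite -dot_eq0 -/n -sqrf_eq0 eq_le n2 sqr_ge0.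
Qed.

End Dot.

(** * Rayleigh quotients and extreme eigenvalues of a symmetric matrix *)

Section Rayleigh.
Variables (R : realType) (d : nat).
Implicit Types (A : 'M[R]_d.+1) (u : 'cV[R]_d.+1).

Lemma dot_mx_continuous A :
  continuous (fun x : 'rV[R]_d.+1 => dot x^T (A *m x^T)).
Proof.
have -> : (fun x : 'rV[R]_d.+1 => dot x^T (A *m x^T)) =
    (fun x : 'rV[R]_d.+1 => \sum_i (x 0 i * \sum_j (A i j * x 0 j))).
  apply/funext => x; rewrite dotE; apply: eq_bigr => i _.
  by rewrite !mxE; congr (_ * _); apply: eq_bigr => j _; rewrite mxE.
have coord i : continuous (fun x : 'rV[R]_d.+1 => x 0 i).
  exact: coord_continuous.
have mul (f g : 'rV[R]_d.+1 -> R) :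
    continuous f -> continuous g -> continuous (fun x => f x * g x).
  by move=> cf cg x; apply: (@cvgM _ _ (nbhs x) _ f g _ _ (cf x) (cg x)).
apply: continuous_big => [|i _].
  exact: add_continuous.
apply: (mul (fun x => x 0 i) (fun x => \sum_j (A i j * x 0 j))) => //.
apply: continuous_big => [|j _].
  exact: add_continuous.
by apply: (mul (fun=> A i j) (fun x => x 0 j)) => //; exact: cst_continuous.
Qed.

(** Compactness of the unit sphere gives a minimizer; homogeneity of degree 2 carries the inequality
    to every [x]. Rows are used because [EVT_min_rV] is about row vectors. *)
Lemma rayleigh_min A : exists2 u, dot u u = 1 &
  forall x, dot u (A *m u) * dot x x <= dot x (A *m x).
Proof.
pose S := [set x : 'rV[R]_d.+1 | dot x^T x^T = 1].
have dot_cont : continuous (fun x : 'rV[R]_d.+1 => dot x^T x^T).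
  rewrite (_ : (fun _ => _) =
    fun x : 'rV[R]_d.+1 => dot x^T (1%:M *m x^T)); first exact: dot_mx_continuous.
  by apply/funext => x; rewrite mul1mx.
have cS : compact S.
  apply: bounded_closed_compact; last first.
    have -> : S = (fun x : 'rV[R]_d.+1 => dot x^T x^T) @^-1` [set y | y = 1] by [].
    by apply: preimage_closed; [move=> x _; exact: dot_cont| exact: closed_eq].
  exists 1; split => // M M1 /= x Sx.
  rewrite [leLHS]/Num.norm /= mx_normrE; apply: bigmax_le; first by lra.
  move=> [i j] _ /=; rewrite ord1; apply: le_trans (ltW M1).
  rewrite -(@ler_pXn2r _ 2)// ?nnegrE// expr1n real_normK ?num_real//.
  rewrite -Sx dotE (bigD1 j)//= !mxE -expr2 lerDl.
  by apply: sumr_ge0 => k _; rewrite mxE -expr2 sqr_ge0.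
have [||u Su umin] := @EVT_min_rV R d.+1 (fun x : 'rV[R]_d.+1 => dot x^T (A *m x^T)) S _ cS.
- exists (delta_mx 0 0); rewrite /S/= dotE (bigD1 0)//= big1 => [|i i0].
    by rewrite !mxE eqxx mulr1 addr0.
  by rewrite !mxE eqxx (negbTE i0) mulr0.
- by apply: continuous_subspaceT; exact: dot_mx_continuous.
exists u^T; first by move: Su; rewrite inE.
move=> x; have [->|x0] := eqVneq x 0; first by rewrite mulmx0 !dot0r mulr0.
have xx : 0 < dot x x by rewrite dot_gt0.
have e0 : enorm x != 0 by rewrite enorm_eq0.
have := umin ((enorm x)^-1 *: x^T); rewrite linearZ/= trmxK.
rewrite -scalemxAr !dot_lin mulrA -invfM -expr2 enorm_sqr.
rewrite mulrC ler_pdivlMr//; apply.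
rewrite inE /S/= linearZ/= trmxK !dot_lin mulrA -invfM -expr2 enorm_sqr mulVf//.
by rewrite gt_eqF.
Qed.

(** [eigenvalue] is about row vectors [v *m A]; symmetry lets transposition turn them into
    columns. *)
Lemma eigenvalue_sym A a : A^T = A ->
  eigenvalue A a <-> exists2 x : 'cV[R]_d.+1, x != 0 & A *m x = a *: x.
Proof.
move=> As; split => [/eigenvalueP[v vA v0]|[x x0 Ax]].
  exists v^T; first by rewrite trmx_eq0.
  by rewrite -[in LHS]As -trmx_mul vA linearZ.
apply/eigenvalueP; exists x^T; last by rewrite trmx_eq0.
by rewrite -[in LHS]As -trmx_mul Ax linearZ.
Qed.

(** For the minimal Rayleigh quotient [a], the matrix [A - a%:M] is positive semidefinite and its
    form vanishes at the minimizer, so [psd_ker] makes the minimizer an eigenvector. *)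
Lemma rayleigh_eigen A : A^T = A -> exists2 a, exists2 u, dot u u = 1 & A *m u = a *: u &
  forall x, a * dot x x <= dot x (A *m x).
Proof.
move=> As; have [u uu umin] := rayleigh_min A.
exists (dot u (A *m u)) => //; exists u => //.
set a := dot u _ in umin *.
have : (A - a%:M) *m u = 0.
  apply: psd_ker; first by rewrite linearB/= As tr_scalar_mx.
    by move=> x; rewrite mulmxBl mul_scalar_mx !dot_lin subr_ge0.
  by rewrite mulmxBl mul_scalar_mx !dot_lin uu mulr1 subrr.
by rewrite mulmxBl mul_scalar_mx => /eqP; rewrite subr_eq0 => /eqP.
Qed.

Lemma lambda_min_eigen A : A^T = A ->
  (exists2 u, dot u u = 1 & A *m u = lambda_min A *: u) /\
  forall x, lambda_min A * dot x x <= dot x (A *m x).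
Proof.
move=> As; have [a [u uu Au] amin] := rayleigh_eigen As.
suff -> : lambda_min A = a by split => //; exists u.
have Ea : [set b : R | eigenvalue A b] a.
  apply/(eigenvalue_sym _ As); exists u => //.
  by rewrite -dot_gt0 uu.
have lb : lbound [set b : R | eigenvalue A b] a.
  move=> b /= /(eigenvalue_sym _ As)[x x0 Ax].
  by have := amin x; rewrite Ax dotZr ler_pM2r// dot_gt0.
apply/eqP; rewrite eq_le; apply/andP; split.
  by apply: ge_inf => //; exists a.
by apply: lb_le_inf => //; exists a.
Qed.

Lemma lambda_max_ge A : A^T = A ->
  forall x, dot x (A *m x) <= lambda_max A * dot x x.
Proof.
move=> As; have NAs : (- A)^T = - A by rewrite linearN/= As.
have [a [u uu Au] amin] := rayleigh_eigen NAs.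
have le_a x : dot x (A *m x) <= - a * dot x x.
  by have := amin x; rewrite mulNmx dotNr lerNr mulNr.
suff -> : lambda_max A = - a by [].
have Ea : [set b : R | eigenvalue A b] (- a).
  apply/(eigenvalue_sym _ As); exists u; first by rewrite -dot_gt0 uu.
  by rewrite scaleNr -Au mulNmx opprK.
have ub : ubound [set b : R | eigenvalue A b] (- a).
  move=> b /= /(eigenvalue_sym _ As)[x x0 Ax].
  by have := le_a x; rewrite Ax dotZr ler_pM2r// dot_gt0.
apply/eqP; rewrite eq_le; apply/andP; split.
  by apply: ge_sup => //; exists (- a).
by apply: ub_le_sup => //; exists (- a).
Qed.

End Rayleigh.

(** * Accelerated gradient iterates in a Krylov space *)

Section Krylov.
Variables (R : realType) (d : nat).
Implicit Types (x b : 'cV[R]_d) (A : 'M[R]_d).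

Lemma krylov_base A b t : (0 < t)%N -> b \in krylov A b t.
Proof.
case: t => // t _; apply: memv_span; apply/mapP; exists 0%N.
  by rewrite mem_iota.
by rewrite expr0 mul1mx.
Qed.

Lemma krylov_mul A b t x : x \in krylov A b t -> A *m x \in krylov A b t.+1.
Proof.
move=> /(memv_img (linfun (mulmx A))); rewrite lfunE/= limg_span.
apply: subvP; apply: sub_span => v /mapP[w /mapP[i i_t ->] ->].
apply/mapP; exists i.+1; first by move: i_t; rewrite !mem_iota.
by rewrite lfunE/= exprS mulmxA.
Qed.

Lemma krylovW A b t t' x : (t <= t')%N -> x \in krylov A b t -> x \in krylov A b t'.
Proof.
move=> tt'; apply: subvP; apply: sub_span => v /mapP[i i_t ->].
apply/mapP; exists i => //; move: i_t; rewrite !mem_iota !add0n.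
by move=> /leq_trans; exact.
Qed.

Lemma krylov_mul_shift A a b t x :
  x \in krylov A b t -> (A - a%:M) *m x \in krylov A b t.+1.
Proof.
move=> xK; rewrite mulmxBl mul_scalar_mx rpredB ?krylov_mul// rpredZ//.
exact: krylovW xK.
Qed.

End Krylov.

Section AcceleratedGradient.
Variables (R : realType) (d : nat).
Implicit Types (x y z u b p : 'cV[R]_d) (A M : 'M[R]_d).

(** This is the variational inequality of the projection of [rho^-1 *: p] onto the ball. The
    projection is a multiple of [p], which keeps the iterates in the Krylov space. *)
Lemma ball_projection p rho r : 0 < rho -> 0 < r ->
  exists a, dot (a *: p) (a *: p) <= r ^+ 2 /\
    forall u, dot u u <= r ^+ 2 -> dot (p - rho *: (a *: p)) (u - a *: p) <= 0.
Proof.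
move=> rho0 r0.
have [pr|pr] := leP (dot (rho^-1 *: p) (rho^-1 *: p)) (r ^+ 2).
  exists rho^-1; split => // u _.
  by rewrite scalerA mulfV ?gt_eqF// scale1r subrr dot0l.
have p0 : p != 0.
  by apply: contraTneq pr => ->; rewrite scaler0 dot0l -leNgt sqr_ge0.
have e0 : 0 < enorm p by rewrite lt_def enorm_ge0 enorm_eq0 p0.
have e2 := enorm_sqr p.
exists (r / enorm p); split => [|u ur].
  by rewrite !dot_lin -e2 le_eqVlt; apply/orP; left; apply/eqP; field; rewrite gt_eqF.
(* Hence the residual [p - rho *: (a *: p)] is a positive multiple of [p], and Cauchy-Schwarz
   concludes. *)
have rp : rho * r < enorm p.
  rewrite -(@ltr_pXn2r _ 2)// ?nnegrE ?enorm_ge0 ?mulr_ge0 ?ltW//.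
  move: pr; rewrite !dot_lin -e2 exprMn.
  rewrite (_ : rho^-1 * (rho^-1 * enorm p ^+ 2) = enorm p ^+ 2 / rho ^+ 2); last first.
    by field; rewrite gt_eqF.
  by rewrite ltr_pdivlMr ?exprn_gt0// mulrC.
have pu : dot p u <= enorm p * r.
  apply: le_trans (ler_norm _) _; apply: le_trans (dot_le_enorm _ _) _.
  by rewrite ler_pM2l// enorm_le// ltW.
rewrite (_ : p - _ = (1 - rho * (r / enorm p)) *: p); last first.
  by rewrite scalerBl scale1r scalerA.
rewrite dotZl pmulr_rle0.
  by rewrite !dot_lin -e2 subr_le0 (le_trans pu)// le_eqVlt; apply/orP; left; apply/eqP; field; rewrite gt_eqF.
by rewrite subr_gt0 mulrA ltr_pdivrMr// mul1r.
Qed.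

Variables (M : 'M[R]_d) (b : 'cV[R]_d) (mu L r : R).
Hypotheses (Msym : M^T = M) (Mpos : forall x, 0 <= dot x (M *m x))
  (ML : forall x, dot x (M *m x) <= L * dot x x)
  (mu0 : 0 <= mu) (L0 : 0 < L) (r0 : 0 < r).

(** [M] will be [A - lambda_min] and [mu] either [lambda_min], when nonnegative, or 0, when the
    concave part is treated separately. *)
Let F x := 2^-1 * dot x (M *m x) + dot b x + mu / 2 * dot x x.

(* One step of the proximal accelerated gradient method, where the gradient
   step is taken on the part of F without the mu-term; the projection onto the
   ball is a rescaling, so the iterates remain in the Krylov space. *)
Lemma accelerated_step x z th : 0 < th <= 1 ->
  dot x x <= r ^+ 2 -> dot z z <= r ^+ 2 ->
  exists a, let z' := a *: ((th * L) *: z - M *m ((1 - th) *: x + th *: z) - b) in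
    let x' := (1 - th) *: x + th *: z' in
    [/\ dot z' z' <= r ^+ 2, dot x' x' <= r ^+ 2 &
    forall u, dot u u <= r ^+ 2 ->
      F x' - F u + th ^+ 2 * L / 2 * dot (u - z') (u - z') <=
      (1 - th) * (F x - F u) + th ^+ 2 * L / 2 * dot (u - z) (u - z)].
Proof.
move=> /andP[th0 th1] xr zr.
set y := (1 - th) *: x + th *: z; set p := _ - b.
have rho0 : 0 < mu + th * L by rewrite ltr_wpDl// mulr_gt0.
have [a [z'r proj]] := ball_projection p rho0 r0.
exists a => z' x'; rewrite -/z' in z'r proj; clearbody z'.
have xz' := dot_ge0 (x - z').
have x'r : dot x' x' <= r ^+ 2.
  apply: (@le_trans _ _ ((1 - th) * dot x x + th * dot z' z')).
    rewrite -subr_ge0 (_ : _ - _ = th * (1 - th) * dot (x - z') (x - z')).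
      by rewrite mulr_ge0// mulr_ge0 ?subr_ge0// ltW.
    by rewrite /x' !dot_lin (dotC z' x); ring.
  rewrite (_ : r ^+ 2 = (1 - th) * r ^+ 2 + th * r ^+ 2); last by ring.
  by rewrite lerD// ler_wpM2l// ?subr_ge0// ltW.
split => // u ur.
have s v w : dot v (M *m w) = dot w (M *m v) by rewrite dotC dot_sym.
rewrite -subr_ge0.
have dual := proj u ur.
(* A sum of nonnegative terms: convexity of the [M]-form at [x] and [u] relative to [y], the slack
   of [M <= L] on [x' - y = th *: (z' - z)], the projection inequality, and strong convexity of the
   [mu]-term. *)
rewrite (_ : _ - _ =
    (1 - th) / 2 * dot (x - y) (M *m (x - y)) + th / 2 * dot (u - y) (M *m (u - y))
    + 2^-1 * (L * dot (th *: (z' - z)) (th *: (z' - z))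
              - dot (th *: (z' - z)) (M *m (th *: (z' - z))))
    - th * dot (p - (mu + th * L) *: z') (u - z')
    + mu / 2 * (th * (1 - th) * dot (x - z') (x - z') + th * dot (u - z') (u - z'))).
  have t1 : 0 <= 1 - th by rewrite subr_ge0.
  have h2 : (0 : R) <= 2^-1 by rewrite invr_ge0.
  rewrite !addr_ge0// ?mulr_ge0 ?subr_ge0 ?addr_ge0 ?mulr_ge0 ?dot_ge0 ?(ltW th0)//.
  by rewrite oppr_ge0 mulr_ge0_le0// ltW.
rewrite /F /p /y /x' !(mulmxDr, mulmxBr, =^~scalemxAr, mulmxN, dot_lin).
rewrite !(dot_sym _ _ Msym) (s z x) (s z' x) (s z' z) (s u x) (s u z).
rewrite (dotC z' x) (dotC z' z) (dotC u z) (dotC u z').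
by field.
Qed.

Lemma accelerated_gradient A c t u : M = A - c%:M -> dot u u <= r ^+ 2 ->
  exists x, [/\ x \in krylov A b t.+1, dot x x <= r ^+ 2 &
    F x - F u <= 2 * L * r ^+ 2 / t.+2%:R ^+ 2].
Proof.
move=> Mdef ur.
have stepK k a (x z : 'cV[R]_d) e f g : x \in krylov A b k.+1 -> z \in krylov A b k.+1 ->
    a *: (e *: z - M *m (f *: x + g *: z) - b) \in krylov A b k.+2.
  move=> xK zK; rewrite rpredZ// rpredB ?krylov_base// rpredB//.
    by rewrite rpredZ//; exact: krylovW zK.
  by rewrite Mdef krylov_mul_shift// rpredD// rpredZ.
(* Since [th 0 = 1], the first step forgets the value at the starting point 0;
   [th t ^+ 2 * L / 2 * r ^+ 2] is the claimed rate. *)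
pose th k : R := 2 / k.+2%:R.
(* The potential argument needs [F u < F x] at each step; as soon as it fails, [x] already serves
   and stays in all larger Krylov spaces. *)
suff [[x [xK xr xu]]|[x [z [xK zK xr zr pot]]]] :
    (exists x, [/\ x \in krylov A b t.+1, dot x x <= r ^+ 2 & F x <= F u]) \/
    (exists x z, [/\ x \in krylov A b t.+1, z \in krylov A b t.+1,
      dot x x <= r ^+ 2, dot z z <= r ^+ 2 &
      F x - F u + th t ^+ 2 * L / 2 * dot (u - z) (u - z) <=
      th t ^+ 2 * L / 2 * dot u u]).
- exists x; split => //; apply: (@le_trans _ _ 0); first by rewrite subr_le0.
  by rewrite mulr_ge0 ?invr_ge0 ?exprn_ge0// mulr_ge0 ?exprn_ge0 ?(ltW r0)// mulr_ge0// ltW.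
- exists x; split => //.
  have c0 : 0 <= th t ^+ 2 * L / 2 by rewrite mulr_ge0// mulr_ge0 ?sqr_ge0// ltW.
  apply: (@le_trans _ _ (th t ^+ 2 * L / 2 * dot u u)).
    by apply: le_trans pot; rewrite lerDl mulr_ge0// dot_ge0.
  apply: (@le_trans _ _ (th t ^+ 2 * L / 2 * r ^+ 2)); first by rewrite ler_wpM2l.
  by rewrite le_eqVlt; apply/orP; left; apply/eqP; rewrite /th; field.
elim: t => [|t [[x [xK xr xu]]|[x [z [xK zK xr zr pot]]]]].
- right; have b00 : dot (0 : 'cV[R]_d) 0 <= r ^+ 2 by rewrite dot0l sqr_ge0.
  have th01 : 0 < th 0%N <= 1 by rewrite /th divff ?pnatr_eq0// ltr01 lexx.
  have [a [z'r x'r /(_ u ur)]] := accelerated_step th01 b00 b00.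
  move: z'r x'r; set z' := a *: _ => z'r x'r step.
  have z'K : z' \in krylov A b 1.
    by rewrite /z' !scaler0 addr0 mulmx0 subr0 add0r rpredZ// rpredN krylov_base.
  exists ((1 - th 0%N) *: 0 + th 0%N *: z'), z'; split => //.
    by rewrite scaler0 add0r rpredZ.
  apply: le_trans step _.
  by rewrite {1}/th divff ?pnatr_eq0// subrr mul0r add0r subr0.
- by left; exists x; split => //; exact: krylovW xK.
have [xu|ux] := leP (F x) (F u).
  by left; exists x; split => //; exact: krylovW xK.
right; have th01 : 0 < th t.+1 <= 1.
  by rewrite /th divr_gt0//= ler_pdivrMr// mul1r ler_nat.
have [a [z'r x'r /(_ u ur)]] := accelerated_step th01 xr zr.
move: z'r x'r; set z' := a *: _ => z'r x'r step.
have z'K : z' \in krylov A b t.+2 by exact: stepK.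
exists ((1 - th t.+1) *: x + th t.+1 *: z'), z'; split => //.
  by rewrite rpredD// rpredZ//; exact: krylovW xK.
apply: le_trans step _.
rewrite -lerBrDr -mulrBr; set E := dot u u - _.
have xuE : F x - F u <= th t ^+ 2 * (L / 2 * E).
  by move: pot; rewrite -lerBrDr -mulrBr -/E; congr (_ <= _); ring.
have E0 : 0 <= L / 2 * E.
  rewrite -subr_gt0 in ux; have := lt_le_trans ux xuE.
  by rewrite pmulr_rgt0 ?exprn_gt0// /th ?divr_gt0// => /ltW.
have t1 : 0 <= 1 - th t.+1 by rewrite subr_ge0; case/andP: th01.
apply: le_trans (ler_wpM2l t1 xuE) _.
rewrite [leRHS](_ : _ = th t.+1 ^+ 2 * (L / 2 * E)); last by ring.
rewrite [leLHS]mulrA.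
(* The weights satisfy (1 - th') th^2 <= th'^2 for consecutive th, th', because (t+2)^2 - (t+1)(t+3)
   = 1. *)
apply: ler_wpM2r => //; rewrite /th -subr_ge0.
have t0 : (0 : R) <= t%:R by [].
rewrite -(addn3 t) -(addn2 t) !natrD.
rewrite (_ : _ - _ = 4 / ((t%:R + 3) ^+ 2 * (t%:R + 2) ^+ 2)).
  by rewrite divr_ge0// mulr_ge0// sqr_ge0.
by field; rewrite !gt_eqF ?ltr_wpDl.
Qed.

End AcceleratedGradient.

(** * Chebyshev polynomials and the Lanczos estimate *)

Section Lanczos.
Variable R : realType.

(** For [x < 1] this bounds [expR (2 * x)] by (1 + x)/(1 - x), the growth rate of the Chebyshev
    values. The difference of the sides vanishes at 0 and has nonnegative derivative, since exp(-2y)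
    >= 1 - 2y. *)
Lemma expR_double_le (x : R) : 0 <= x -> (1 - x) * expR (2 * x) <= 1 + x.
Proof.
move=> x0; pose h (y : R) := 1 + y - (1 - y) * expR (2 * y).
have dh (y : R) : is_derive y 1 h (1 + (2 * y - 1) * expR (2 * y)).
  by apply: is_derive_eq; rewrite /GRing.scale/=; ring.
rewrite -subr_ge0 -/(h x) (_ : 0 = h 0); last first.
  by rewrite /h mulr0 expR0; ring.
apply: (@ger0_derive1_ndecr _ h 0 x) => //.
- move=> y _; rewrite derive1E (@derive_val _ _ _ _ _ _ _ (dh y)).
  have := expR_ge1Dx (- (2 * y)).
  rewrite -(ler_pM2r (expR_gt0 (2 * y))) -expRD addNr expR0 => e.
  by rewrite (_ : 1 + _ = 1 - (1 - 2 * y) * expR (2 * y)) ?subr_ge0//; ring.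
- by apply: derivable_within_continuous => y _; exact: (@ex_derive _ _ _ _ _ _ _ (dh y)).
Qed.

(* [(cheb k).1] and [(cheb k).2] are T_{2k+1}(s)/s and the analogous quotient of
   sin((2k+1)a) by sin a, for 'X = s^2 = cos(a)^2; a step is a rotation by 2a. *)
Fixpoint cheb (k : nat) : {poly R} * {poly R} :=
  if k is k'.+1 then
    let: (V, W) := cheb k' in
    ((2 *: 'X - 1) * V - 2 *: ((1 - 'X) * W), (2 *: 'X - 1) * W + 2 *: ('X * V))
  else (1, 1).

(** This is cos^2 + sin^2 = 1 at the angle (2k+1)a; as a polynomial identity it also applies to
    matrices. *)
Lemma cheb_rotation k :
  'X * (cheb k).1 ^+ 2 + (1 - 'X) * (cheb k).2 ^+ 2 = 1.
Proof.
elim: k => [|k] /=; first by ring.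
case: (cheb k) => V W /= VW.
by rewrite -[RHS]VW !scaler_nat; ring.
Qed.

(** With [tau] = tanh h one has [S] = sinh^2 h and [rho] = exp(2h); up to sign the two values at [w]
    are sinh((2k+1)h)/sinh h and cosh((2k+1)h)/cosh h. The second plus [tau] times the first is
    [rho ^+ k * (1 + tau)], and sinh <= cosh leaves at least half of it for the second. *)
Lemma cheb_growth k (tau : R) : 0 <= tau < 1 ->
  let rho := (1 + tau) / (1 - tau) in
  let S := tau ^+ 2 / (1 - tau ^+ 2) in
  let w := - S in
  [/\ 1 <= (-1) ^+ k * (cheb k).1.[w],
      rho ^+ k / 2 * (1 + tau) <= (-1) ^+ k * (cheb k).2.[w] &
      tau * ((-1) ^+ k * (cheb k).1.[w]) <= (-1) ^+ k * (cheb k).2.[w]].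
Proof.
move=> /andP[t0 t1] rho S w.
have t1' : 0 < 1 - tau by rewrite subr_gt0.
have t2 : 0 < 1 - tau ^+ 2.
  rewrite (_ : _ - _ = (1 - tau) * (1 + tau)); last by ring.
  by rewrite mulr_gt0// ltr_wpDr.
suff [V1 W1 sum diff] : [/\ 1 <= (-1) ^+ k * (cheb k).1.[w],
    1 <= (-1) ^+ k * (cheb k).2.[w],
    (-1) ^+ k * (cheb k).2.[w] + tau * ((-1) ^+ k * (cheb k).1.[w])
      = rho ^+ k * (1 + tau) &
    tau * ((-1) ^+ k * (cheb k).1.[w]) <= (-1) ^+ k * (cheb k).2.[w]].
  split => //; rewrite -(@ler_pM2r _ 2)//.
  rewrite (_ : rho ^+ k / 2 * (1 + tau) * 2 = rho ^+ k * (1 + tau)); last by field.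
  by rewrite -sum mulr_natr mulr2n lerD2l.
elim: k => [|k] /=.
  by rewrite !expr0 !mul1r !hornerC mulr1; split => //; rewrite ltW.
case: (cheb k) => V W /=.
rewrite !(hornerD, hornerN, hornerM, hornerZ, hornerX, hornerC) exprS.
set v := V.[w]; set v' := W.[w]; set sg := (-1) ^+ k.
set a := sg * v; set a' := sg * v' => -[a1 a'1 sum diff].
have a0 : 0 <= a by rewrite (le_trans _ a1).
have a'0 : 0 <= a' by rewrite (le_trans _ a'1).
have s0 : 0 <= S by rewrite divr_ge0 ?sqr_ge0// ltW.
rewrite (_ : -1 * sg * ((2 * w - 1) * v - 2 * ((1 - w) * v')) =
   (1 + 2 * S) * a + 2 * (1 + S) * a'); last by rewrite /w /a /a'; ring.
rewrite (_ : -1 * sg * ((2 * w - 1) * v' + 2 * (w * v)) =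
   (1 + 2 * S) * a' + 2 * S * a); last by rewrite /w /a /a'; ring.
have Sa : 0 <= S * a by rewrite mulr_ge0.
have Sa' : 0 <= S * a' by rewrite mulr_ge0.
have n1 : 1 - tau != 0 by rewrite gt_eqF.
have n2 : 1 - tau ^+ 2 != 0 by rewrite gt_eqF.
split.
- by lra.
- by lra.
- by rewrite exprS -[RHS]mulrA -sum /rho /S; field; rewrite n1 n2.
- rewrite -subr_ge0 (_ : _ - _ = (1 - tau) / (1 + tau) * (a' - tau * a)).
    by rewrite mulr_ge0 ?subr_ge0// divr_ge0 ?ltW// ltr_pwDl.
  by rewrite /S; field; rewrite n2 gt_eqF// ltr_pwDl.
Qed.

End Lanczos.

(** * A Krylov vector with a small Rayleigh quotient *)

Section LanczosVector.
Variables (R : realType) (d : nat).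
Implicit Types (x y z u b : 'cV[R]_d.+1) (A M : 'M[R]_d.+1) (p : {poly R}).

Lemma tr_horner_mx A p : A^T = A -> (horner_mx A p)^T = horner_mx A p.
Proof.
move=> As; elim/poly_ind: p => [|p a IH]; first by rewrite rmorph0 linear0.
rewrite rmorphD rmorphM/= horner_mx_X horner_mx_C linearD/= tr_scalar_mx.
rewrite -[_ * A]/(_ *m A) trmx_mul IH As; congr (_ + _).
by apply: comm_mx_horner.
Qed.

Lemma horner_mx_eigen A p x a : A *m x = a *: x ->
  horner_mx A p *m x = p.[a] *: x.
Proof.
move=> Ax; elim/poly_ind: p => [|p e IH].
  by rewrite rmorph0 mul0mx horner0 scale0r.
rewrite rmorphD rmorphM/= horner_mx_X horner_mx_C mulmxDl mul_scalar_mx.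
rewrite -[_ * A]/(_ *m A) -mulmxA Ax -scalemxAr IH scalerA -scalerDl.
by rewrite hornerD hornerM hornerX hornerC mulrC.
Qed.

Lemma krylov_cheb A b e f k :
  let B := e *: (A - f%:M) in
  horner_mx B (cheb R k).1 *m b \in krylov A b k.+1 /\
  horner_mx B (cheb R k).2 *m b \in krylov A b k.+1.
Proof.
move=> B; elim: k => [|k] /=; first by rewrite rmorph1 mul1mx krylov_base.
have BK x : x \in krylov A b k.+1 -> B *m x \in krylov A b k.+2.
  by move=> xK; rewrite -scalemxAl rpredZ// krylov_mul_shift.
have K x : x \in krylov A b k.+1 -> x \in krylov A b k.+2 by exact: krylovW.
case: (cheb R k) => V W /= [Vb Wb].
have E p q g x : (horner_mx B (g *: (p * q))) *m x =
    g *: (horner_mx B p *m (horner_mx B q *m x)).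
  by rewrite linearZ/= rmorphM/= -scalemxAl mulmxA.
have X2 x : horner_mx B (2 *: 'X - 1) *m x = 2 *: (B *m x) - x.
  by rewrite rmorphB/= linearZ/= horner_mx_X rmorph1 mulmxBl mul1mx -scalemxAl.
have X1 x : horner_mx B (1 - 'X) *m x = x - B *m x.
  by rewrite rmorphB/= horner_mx_X rmorph1 mulmxBl mul1mx.
split.
  rewrite rmorphB mulmxBl E X1 rmorphM/= -mulmxA X2.
  by rewrite rpredB// ?rpredZ ?rpredB ?rpredZ ?BK ?K.
rewrite rmorphD mulmxDl E horner_mx_X rmorphM/= -mulmxA X2.
by rewrite rpredD ?rpredB ?rpredZ ?BK ?K.
Qed.

(** The affine image [B] of [M] sends [e, D] to [0, 1] and the eigenvalue 0 to [- S], so the claim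
    for z = V b reads [dot z (B *m z) <= 0]. The component of [b] along [u] contributes a large
    negative term, the orthogonal component [b'] at most [dot b' b']. *)
Lemma lanczos A M (c D l : R) b u t : M = A - c%:M -> M^T = M ->
  (forall x, 0 <= dot x (M *m x)) -> (forall x, dot x (M *m x) <= D * dot x x) ->
  M *m u = 0 -> dot u u = 1 -> dot u b != 0 -> 0 <= l ->
  4 * dot b b <= expR (2 * l) * dot u b ^+ 2 ->
  exists z, [/\ z \in krylov A b t.+1, z != 0 &
    dot z (M *m z) <= D * (l / (2 * t%:R + 1)) ^+ 2 * dot z z].
Proof.
move=> Mdef Ms Mpos MD Mu uu ub l0 bl.
have t1 : 0 < 2 * t%:R + 1 :> R by rewrite ltr_wpDl// mulr_ge0.
set tau := l / _.
have b0 : b != 0 by apply: contraNneq ub => ->; rewrite dot0r.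
have D0 : 0 <= D by have := le_trans (Mpos u) (MD u); rewrite uu mulr1.
have tau0 : 0 <= tau by rewrite divr_ge0// ltW.
(* For [tau >= 1], or for [D = 0], the vector [b] itself works, as no quotient exceeds [D]. *)
have [tau1|tau1] := leP 1 tau.
  exists b; split => //; first exact: krylov_base.
  apply: le_trans (MD b) _; rewrite ler_wpM2r ?dot_ge0//.
  by rewrite ler_peMr// exprn_ege1.
move: D0; rewrite le_eqVlt => /predU1P[D0|D0].
  exists b; split => //; first exact: krylov_base.
  by rewrite (le_trans (MD b))// -D0 !mul0r.
have n1 : 0 < 1 - tau by rewrite subr_gt0.
have n2 : 0 < 1 + tau by rewrite ltr_wpDr.
have n3 : 0 < 1 - tau ^+ 2.
  by rewrite (_ : _ - _ = (1 - tau) * (1 + tau)) ?mulr_gt0//; ring.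
pose e := D * tau ^+ 2.
have De : 0 < D - e.
  by rewrite (_ : D - e = D * (1 - tau ^+ 2)) ?mulr_gt0// /e; ring.
pose B := (D - e)^-1 *: (A - (c + e)%:M).
have BE : B = (D - e)^-1 *: (M - e%:M).
  by rewrite /B Mdef; congr (_ *: _); rewrite -addrA -opprD -raddfD.
have Bs : B^T = B by rewrite BE linearZ/= linearB/= Ms tr_scalar_mx.
set S := tau ^+ 2 / (1 - tau ^+ 2).
have Bu : B *m u = - S *: u.
  rewrite BE -scalemxAl mulmxBl Mu mul_scalar_mx sub0r scalerN scalerA -scaleNr.
  congr (_ *: u); rewrite /S /e; field.
  by rewrite gt_eqF// gt_eqF.
set V := horner_mx B (cheb R t).1; set W := horner_mx B (cheb R t).2.
have Vs : V^T = V by exact: tr_horner_mx.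
have Ws : W^T = W by exact: tr_horner_mx.
have [Vb _] := krylov_cheb A b (D - e)^-1 (c + e) t.
rewrite -/B -/V in Vb.
have [v1 w1 _] := cheb_growth t (introT andP (conj tau0 tau1)).
rewrite -/S in v1 w1.
set v := (cheb R t).1.[- S] in v1; set w := (cheb R t).2.[- S] in w1.
have Vu : V *m u = v *: u by exact: horner_mx_eigen.
have vw : - S * v ^+ 2 + (1 + S) * w ^+ 2 = 1.
  have := congr1 (horner^~ (- S)) (cheb_rotation R t).
  rewrite !(hornerD, hornerM, hornerN, hornerX, hornerC, horner_exp) -/v -/w.
  by rewrite opprK.
have VW : B *m (V *m V) + (1%:M - B) *m (W *m W) = 1%:M.
  have := congr1 (horner_mx B) (cheb_rotation R t).
  by rewrite !expr2 rmorphD !rmorphM/= rmorphB/= horner_mx_X !rmorph1.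
have BV : B *m V = V *m B by apply/esym/comm_horner_mx.
have BW : B *m W = W *m B by apply/esym/comm_horner_mx.
pose b' := b - dot u b *: u.
have ub' : dot u b' = 0 by rewrite !dot_lin uu mulr1 subrr.
have b'b' : dot b' b' = dot b b - dot u b ^+ 2.
  by rewrite !dot_lin uu (dotC b u); ring.
have bE : b = dot u b *: u + b' by rewrite /b' addrC subrK.
clearbody b'.
(* By [VW], B V^2 = 1 - (1 - B) W^2, and 1 - B is positive semidefinite because [M <= D]. *)
have Bv' : dot (V *m b') (B *m (V *m b')) <= dot b' b'.
  have -> : dot (V *m b') (B *m (V *m b')) =
      dot b' b' - dot (W *m b') ((1%:M - B) *m (W *m b')).
    apply/eqP; rewrite -subr_eq0 opprB addrA [_ + dot (W *m b') _]addrC; apply/eqP.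
    rewrite (dot_sym _ _ Vs) (dot_sym _ _ Ws).
    rewrite (_ : V *m (B *m (V *m b')) = (B *m (V *m V)) *m b'); last first.
      by rewrite !mulmxA BV.
    rewrite (_ : W *m ((1%:M - B) *m (W *m b')) =
      ((1%:M - B) *m (W *m W)) *m b'); last first.
      by rewrite !mulmxA mulmxBr mulmx1 -BW !mulmxBl !mul1mx.
    by rewrite -dotDr -mulmxDl [_ + B *m _]addrC VW mul1mx subrr.
  rewrite gerBl (_ : 1%:M - B = (D - e)^-1 *: (D%:M - M)).
    rewrite -scalemxAl dotZr mulr_ge0 ?invr_ge0 ?(ltW De)//.
    by rewrite mulmxBl mul_scalar_mx !dot_lin subr_ge0.
  rewrite BE -[1%:M](@scalerK _ _ (D - e)); last by rewrite gt_eqF.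
  rewrite -scalerBr scalemx1; congr (_ *: _).
  by rewrite raddfB/= opprB addrA subrK.
exists (V *m b); split => //.
  apply: contraTneq isT => Vb0.
  have : dot u (V *m b) = v * dot u b by rewrite -(dot_sym _ _ Vs) Vu dotZl.
  rewrite Vb0 dot0r => /esym/eqP; rewrite mulf_eq0 (negbTE ub) orbF => /eqP v0.
  by move: v1; rewrite v0 mulr0 ler10.
suff Bz : dot (V *m b) (B *m (V *m b)) <= 0.
  rewrite -/e.
  have -> : M = (D - e) *: B + e%:M.
    by rewrite BE scalerA mulfV ?gt_eqF// scale1r subrK.
  rewrite mulmxDl -scalemxAl mul_scalar_mx !dot_lin gerDr.
  by rewrite pmulr_rle0.
have -> : dot (V *m b) (B *m (V *m b)) =
    - S * v ^+ 2 * dot u b ^+ 2 + dot (V *m b') (B *m (V *m b')).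
  have uV : dot u (V *m b') = 0 by rewrite -(dot_sym _ _ Vs) Vu dotZl ub' mulr0.
  rewrite {1 2}bE !mulmxDr -!scalemxAr Vu -!scalemxAr Bu !dot_lin uu.
  rewrite -(dot_sym u _ Bs) Bu (dotC (V *m b') u) dotZl uV; ring.
apply: le_trans (lerD (lexx _) Bv') _; rewrite b'b'.
have -> : - S * v ^+ 2 * dot u b ^+ 2 + (dot b b - dot u b ^+ 2) =
    dot b b - (1 + S) * w ^+ 2 * dot u b ^+ 2.
  by rewrite (_ : (1 + S) * w ^+ 2 = 1 + S * v ^+ 2); [|apply: (addrI (- S * v ^+ 2)); rewrite vw]; ring.
rewrite subr_le0 -(@ler_pM2l _ 4)//; apply: le_trans bl _.
rewrite [leRHS]mulrA ler_wpM2r ?sqr_ge0//.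
pose rho := (1 + tau) / (1 - tau).
have rho0 : 0 <= rho by rewrite divr_ge0 ?ltW.
have w2 : (rho ^+ t / 2 * (1 + tau)) ^+ 2 <= w ^+ 2.
  have := w1; rewrite -(@ler_pXn2r _ 2)// ?nnegrE; first by rewrite [leRHS]exprMn sqrr_sign mul1r.
    by rewrite !mulr_ge0 ?exprn_ge0// ltW.
  by apply: le_trans w1; rewrite !mulr_ge0 ?exprn_ge0// ltW.
(* Here 2l = (2t+1)(2 tau) and exp(2 tau) <= rho bound the exponential by this power, which equals
   4(1+S)(rho^t (1+tau)/2)^2 because (1+S)(1+tau)^2 = rho. *)
apply: (@le_trans _ _ (rho ^+ (2 * t).+1)).
  have rhoe : expR (2 * tau) <= rho.
    by rewrite ler_pdivlMr// mulrC expR_double_le.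
  rewrite (_ : 2 * l = (2 * tau) *+ (2 * t).+1).
    rewrite -[X in expR X]mulr_natr expRM_natr lerXn2r// nnegrE ?expR_ge0//.
  rewrite -[RHS]mulr_natr (_ : (2 * t)%N.+1%:R = 2 * t%:R + 1 :> R) /tau; first field.
    by rewrite gt_eqF.
  by rewrite -natrM natr1.
apply: le_trans (_ : 4 * ((1 + S) * (rho ^+ t / 2 * (1 + tau)) ^+ 2) <= _).
  rewrite exprS mulnC exprM le_eqVlt; apply/orP; left; apply/eqP.
  rewrite /S /rho; set r := (_ / _) ^+ t; field.
  by rewrite !gt_eqF.
by rewrite ler_pM2l// ler_pM2l// ltr_wpDr// divr_ge0 ?sqr_ge0// ltW.
Qed.

End LanczosVector.

(** * Optimality gaps over a Krylov space *)

(** Cayley-Hamilton with zero determinant gives M^2 = (tr M) M, so [M] kills M b - (tr M) b, whose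
    overlap with [u] is -(tr M)<u, b>. If the trace is 0, then M^2 = 0 and symmetry forces M b = 0,
    so [b] serves. *)
Lemma singular_sym2_kernel (R : realType) (M : 'M[R]_2) (u b : 'cV[R]_2) :
  M^T = M -> M *m u = 0 -> dot u b != 0 ->
  exists e f, let z := e *: b + f *: (M *m b) in z != 0 /\ M *m z = 0.
Proof.
move=> Ms Mu ub.
have u0 : u != 0 by apply: contraNneq ub => ->; rewrite dot0l.
pose a := M 0 0; pose p := M 0 1; pose q := M 1 1.
have sum2 (h : 'I_2 -> R) : \sum_i h i = h 0 + h 1.
  by rewrite !big_ord_recl big_ord0 addr0; congr (_ + h _); exact/val_inj.
have I2 (i : 'I_2) : i = 0 \/ i = 1.
  by case: i => -[|[|//]] ilt; [left|right]; exact/val_inj.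
have p' : M 1 0 = p by rewrite -[in LHS]Ms mxE.
have e0 : a * u 0 0 + p * u 1 0 = 0.
  by have := congr1 (fun x : 'cV[R]_2 => x 0 0) Mu; rewrite !mxE sum2.
have e1 : p * u 0 0 + q * u 1 0 = 0.
  have := congr1 (fun x : 'cV[R]_2 => x 1 0) Mu.
  by rewrite !mxE sum2 p'.
have det0 : a * q - p ^+ 2 = 0.
  apply/eqP; apply: contraNT u0 => det.
  apply/eqP/matrixP => i j; rewrite ord1 mxE.
  apply: (mulfI det); rewrite mulr0.
  have [->|->] := I2 i.
    transitivity (q * (a * u 0 0 + p * u 1 0) - p * (p * u 0 0 + q * u 1 0)); first by ring.
    by rewrite e0 e1 !mulr0 subrr.
  transitivity (a * (p * u 0 0 + q * u 1 0) - p * (a * u 0 0 + p * u 1 0)); first by ring.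
  by rewrite e0 e1 !mulr0 subrr.
have MM : M *m M = (a + q) *: M.
  apply/matrixP => i j; rewrite !mxE sum2.
  have pa : p ^+ 2 = a * q by apply/esym/eqP; rewrite -subr_eq0 det0.
  have [->|->] := I2 i; have [->|->] := I2 j; rewrite ?p' -/a -/p -/q.
  - by rewrite -[p * p]expr2 pa; ring.
  - by ring.
  - by ring.
  - by rewrite -[p * p]expr2 pa; ring.
have uM : dot u (M *m b) = 0 by rewrite -dot_sym// Mu dot0l.
have [aq|aq] := eqVneq (a + q) 0.
  exists 1, 0; rewrite /= scale1r scale0r addr0; split.
    by apply: contraNneq ub => ->; rewrite dot0r.
  apply/eqP; rewrite -dot_eq0 dot_sym// mulmxA MM aq scale0r mul0mx dot0r.
  by [].
exists (- (a + q)), 1; rewrite scale1r; split.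
  apply: contraTneq isT => z0.
  have := congr1 (dot u) z0; rewrite !dot_lin uM addr0 => /eqP.
  by rewrite mulf_eq0 oppr_eq0 (negbTE aq) (negbTE ub).
by rewrite mulmxDr -scalemxAr mulmxA MM -scalemxAl scaleNr addNr.
Qed.

Section KrylovGap.
Variables (R : realType) (d : nat) (A : 'M[R]_d.+1) (b : 'cV[R]_d.+1) (r : R).
Hypotheses (As : A^T = A) (r0 : 0 < r).

Let lo := lambda_min A.
Let D := lambda_max A - lambda_min A.
Let M := A - lo%:M.

Lemma shift_sym : M^T = M.
Proof. by rewrite linearB/= As tr_scalar_mx. Qed.

Lemma shift_psd x : 0 <= dot x (M *m x).
Proof.
rewrite mulmxBl mul_scalar_mx !dot_lin subr_ge0.
exact: (lambda_min_eigen As).2.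
Qed.

Lemma shift_le x : dot x (M *m x) <= D * dot x x.
Proof.
by rewrite mulmxBl mul_scalar_mx !dot_lin mulrBl lerD2r lambda_max_ge.
Qed.

Lemma spread_ge0 : 0 <= D.
Proof.
have [u uu _] := (lambda_min_eigen As).1.
by have := le_trans (shift_psd u) (shift_le u); rewrite uu mulr1.
Qed.

Lemma quad_shift x :
  quad A b x = 2^-1 * dot x (M *m x) + dot b x + lo / 2 * dot x x.
Proof. by rewrite quadE mulmxBl mul_scalar_mx !dot_lin; field. Qed.

(** The slack [e] is there because [accelerated_gradient] wants a positive constant [L], whereas [D]
    is 0 for scalar [A]; [e'] is calibrated so that replacing [D] by [D + e'] costs exactly [e]. *)
Lemma krylov_near_opt mu t u e : 0 <= mu -> dot u u <= r ^+ 2 -> 0 < e ->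
  let F x := 2^-1 * dot x (M *m x) + dot b x + mu / 2 * dot x x in
  exists x, [/\ x \in krylov A b t.+1, dot x x <= r ^+ 2 &
    F x - F u <= 2 * D * r ^+ 2 / t.+2%:R ^+ 2 + e].
Proof.
move=> mu0 ur e0 F.
pose e' := e * t.+2%:R ^+ 2 / (2 * r ^+ 2).
have e'0 : 0 < e' by rewrite divr_gt0 ?mulr_gt0 ?exprn_gt0.
have D'0 : 0 < D + e' by rewrite ltr_wpDl// spread_ge0.
have MD' x : dot x (M *m x) <= (D + e') * dot x x.
  apply: le_trans (shift_le x) _.
  by rewrite ler_wpM2r ?dot_ge0// lerDl ltW.
have [x [xK xr xu]] := accelerated_gradient b shift_sym shift_psd MD' mu0 D'0 r0 t erefl ur.
exists x; split => //; apply: le_trans xu _.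
rewrite le_eqVlt; apply/orP; left; apply/eqP; rewrite /e'; field.
by rewrite !gt_eqF// ltr_wpDr.
Qed.

Variables (t : nat) (s : 'cV[R]_d.+1).
Hypothesis smin :
  is_argmin [set x | x \in krylov A b t.+1 /\ enorm x <= r] (quad A b) s.

Lemma argmin_le x : x \in krylov A b t.+1 -> dot x x <= r ^+ 2 ->
  quad A b s <= quad A b x.
Proof. by move=> xK xr; apply: smin.2; split; rewrite ?enorm_le// ltW. Qed.

Lemma gap_convex u : 0 <= lo -> dot u u <= r ^+ 2 ->
  quad A b s - quad A b u <= 2 * D * r ^+ 2 / t.+2%:R ^+ 2.
Proof.
move=> lo0 ur; apply/ler_addgt0Pr => e e0.
have [x [xK xr xu]] := krylov_near_opt t lo0 ur e0.
apply: le_trans xu; rewrite -!quad_shift lerD2r.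
exact: argmin_le.
Qed.

(* From a near-minimizer x of the convex part, move along +z or -z to the
   sphere, where the concave part is smallest: averaging over the two exit
   points with weights of mean displacement 0 removes the first-order term. *)
Lemma gap_nonconvex u z eps : lo < 0 -> dot u u <= r ^+ 2 ->
  z \in krylov A b t.+1 -> z != 0 -> 0 <= eps ->
  dot z (M *m z) <= eps * dot z z ->
  quad A b s - quad A b u <= 2 * D * r ^+ 2 / t.+2%:R ^+ 2 + eps * r ^+ 2 / 2.
Proof.
move=> lo0 ur zK z0 eps0 zeps; apply/ler_addgt0Pr => e e0.
have [x [xK xr]] := krylov_near_opt t (lexx 0) ur e0.
rewrite !mul0r !addr0; set g := (X in X - _ <= _); set gu := (X in _ - X <= _) => xu.
have zz : 0 < dot z z by rewrite dot_gt0.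
pose q := dot z (M *m z); pose B := dot x (M *m z) + dot b z.
have q0 : 0 <= q by exact: shift_psd.
(* [x + a *: z] lies on the sphere exactly when a^2 + 2 m a = c. *)
pose m := dot x z / dot z z; pose c := (r ^+ 2 - dot x x) / dot z z.
have c0 : 0 <= c by rewrite divr_ge0 ?subr_ge0// ltW.
have along a : a ^+ 2 + 2 * m * a = c ->
    quad A b s - lo / 2 * r ^+ 2 <= g + a * B + a ^+ 2 / 2 * q.
  move=> ac.
  have axr : dot (x + a *: z) (x + a *: z) = r ^+ 2.
    rewrite !dot_lin (dotC z x).
    rewrite (_ : _ + _ = dot x x + (a ^+ 2 + 2 * m * a) * dot z z).
      by rewrite ac /c mulfVK ?gt_eqF// addrC subrK.
    by rewrite /m; field; rewrite gt_eqF.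
  have : quad A b s <= quad A b (x + a *: z).
    by apply: argmin_le; rewrite ?axr// rpredD// rpredZ.
  rewrite (quad_shift (x + _)) axr -lerBlDr => h; apply: le_trans h _.
  rewrite mulmxDr -scalemxAr !dot_lin -(dot_sym z x shift_sym) (dotC _ x).
  by rewrite le_eqVlt; apply/orP; left; apply/eqP; rewrite /B /g /q; field.
pose w := Num.sqrt (m ^+ 2 + c).
have w2 : w ^+ 2 = m ^+ 2 + c by rewrite sqr_sqrtr// addr_ge0 ?sqr_ge0.
have w0 : 0 <= w by exact: sqrtr_ge0.
have mw : `|m| <= w.
  by rewrite -(@ler_pXn2r _ 2)// ?nnegrE// w2 real_normK ?num_real// lerDl.
have key : quad A b s - lo / 2 * r ^+ 2 <= g + c / 2 * q.
  have cE : c = w ^+ 2 - m ^+ 2 by rewrite w2 addrC addKr.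
  have E1 : (w - m) ^+ 2 + 2 * m * (w - m) = c.
    by rewrite [RHS]cE; ring.
  have E2 : (- w - m) ^+ 2 + 2 * m * (- w - m) = c.
    by rewrite [RHS]cE; ring.
  (* The exit parameters [w - m] and [- w - m] get the weights [w + m] and [w - m]: the terms in [B]
     cancel and the squares average to [c]. *)
  move: (along _ E1) (along _ E2) => {E1 E2}.
  move: w0; rewrite le_eqVlt => /predU1P[w0|w0].
    have m0 : m = 0 by apply/eqP; rewrite -normr_le0 w0.
    by rewrite cE -w0 m0 => h1 _; apply: le_trans h1 _; rewrite le_eqVlt; apply/orP; left; apply/eqP; ring.
  move: mw; rewrite ler_norml => /andP[mw1 mw2].
  set Q := quad A b s - _ => h1 h2.
  have wm1 : 0 <= w + m by lra.
  have wm2 : 0 <= w - m by lra.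
  have := lerD (ler_wpM2l wm1 h1) (ler_wpM2l wm2 h2).
  rewrite (_ : _ + _ = (2 * w) * Q); last by ring.
  rewrite (_ : _ + _ = (2 * w) * (g + c / 2 * q)); last by rewrite cE; field.
  by rewrite ler_pM2l// mulr_gt0.
have cq : c / 2 * q <= eps * r ^+ 2 / 2.
  apply: (@le_trans _ _ (c / 2 * (eps * dot z z))).
    by rewrite ler_wpM2l// divr_ge0.
  rewrite [leLHS](_ : _ = eps * (r ^+ 2 - dot x x) / 2); last first.
    by rewrite /c; field; rewrite gt_eqF.
  by rewrite ler_pM2r// ler_wpM2l// gerBl dot_ge0.
have uE : quad A b u = gu + lo / 2 * dot u u by rewrite quad_shift.
have lou : lo / 2 * r ^+ 2 <= lo / 2 * dot u u by rewrite ler_wnM2l//; lra.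
rewrite uE; move: key cq xu lou.
move: (quad A b s) (lo / 2 * r ^+ 2) (lo / 2 * dot u u) (c / 2 * q) => ? ? ? ?.
move: (eps * r ^+ 2 / 2) (2 * D * r ^+ 2 / _) => ? ?.
clearbody g gu; lra.
Qed.

End KrylovGap.

(** Provides ln 16 <= 3. From exp(1/8) >= 9/8 and (9/8)^6 >= 2 follows exp(3/4) >= 2. *)
Lemma expR3_ge16 (R : realType) : 16 <= expR 3 :> R.
Proof.
have e1 : 2 <= expR (3 / 4) :> R.
  apply: (@le_trans _ _ ((9 / 8) ^+ 6)); first by lra.
  rewrite (_ : 3 / 4 = 1 / 8 *+ 6); last by rewrite -mulr_natr; field.
  rewrite -[X in expR X]mulr_natr expRM_natr.
  have e8 : 9 / 8 <= expR (1 / 8) :> R.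
    by apply: le_trans (expR_ge1Dx _); lra.
  by rewrite lerXn2r ?nnegrE ?expR_ge0//; lra.
rewrite (_ : 3 = 3 / 4 * 4%:R :> R); last by field.
rewrite expRM_natr; apply: le_trans (_ : 2 ^+ 4 <= _); first by lra.
by rewrite lerXn2r// ?nnegrE ?expR_ge0.
Qed.

(** The dimension is [d.+1]. In dimension 1 the matrix is 0 and [b] serves. *)
Lemma small_dim_kernel (R : realType) d (M : 'M[R]_d.+1) (u b : 'cV[R]_d.+1) :
  M^T = M -> M *m u = 0 -> dot u u = 1 -> b != 0 -> (d <= 1)%N ->
  (d == 1%N -> dot u b != 0) ->
  exists e f, let z := e *: b + f *: (M *m b) in z != 0 /\ M *m z = 0.
Proof.
case: d M u b => [|[|//]] M u b Ms Mu uu b0 _ d1u; last first.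
  exact: singular_sym2_kernel Ms Mu (d1u isT).
exists 1, 0; rewrite /= scale1r scale0r addr0; split => //.
have u0 : u 0 0 != 0.
  apply/negP => /eqP u0; move: uu; rewrite dotE big_ord1 u0 mul0r => /esym/eqP.
  by rewrite oner_eq0.
have /(congr1 (fun x : 'cV[R]_1 => x 0 0)) := Mu.
rewrite !mxE big_ord1 => /eqP; rewrite mulf_eq0 (negbTE u0) orbF => /eqP M00.
by rewrite (_ : M = 0) ?mul0mx//; apply/matrixP => i j; rewrite !ord1 mxE.
Qed.

(** * Gap bounds for a negative least eigenvalue *)

Section GapBounds.
Variables (R : realType) (d : nat) (A : 'M[R]_d.+1) (b u : 'cV[R]_d.+1) (r : R).
Variables (t : nat) (s : 'cV[R]_d.+1).
Hypotheses (As : A^T = A) (r0 : 0 < r) (lo0 : lambda_min A < 0).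
Hypotheses (uu : dot u u = 1) (Au : A *m u = lambda_min A *: u).
Hypothesis smin :
  is_argmin [set x | x \in krylov A b t.+1 /\ enorm x <= r] (quad A b) s.

Let lo := lambda_min A.
Let D := lambda_max A - lambda_min A.
Let M := A - lo%:M.

Lemma shift_eigen0 : M *m u = 0.
Proof. by rewrite mulmxBl mul_scalar_mx Au subrr. Qed.

(** The Krylov order is [t.+1], hence the denominator t + 1/2. The accelerated term is weakened to
    this denominator; the Lanczos vector adds D (l/(2t+1))^2 r^2/2, which is l^2/8 in units of D
    r^2/(t+1/2)^2. *)
Lemma gap_log y l : dot y y <= r ^+ 2 -> dot u b != 0 -> 0 <= l ->
  4 * dot b b <= expR (2 * l) * dot u b ^+ 2 ->
  quad A b s - quad A b y <= D * r ^+ 2 / (t.+1%:R - 2^-1) ^+ 2 * (2 + l ^+ 2 / 8).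
Proof.
move=> yr ub l0 bl.
have [z [zK z0 zM]] := lanczos t erefl (shift_sym As) (shift_psd As)
  (shift_le As) shift_eigen0 uu ub l0 bl.
have D0 := spread_ge0 As; rewrite -/D in D0 zM.
apply: le_trans (gap_nonconvex As r0 smin lo0 yr zK z0 _ zM) _.
  by rewrite mulr_ge0// sqr_ge0.
have E1 : t.+1%:R = t%:R + 1 :> R by rewrite -addn1 natrD.
have E2 : t.+2%:R = t%:R + 2 :> R by rewrite -addn2 natrD.
rewrite -/D E1 E2.
have t0 : 0 <= t%:R :> R by [].
rewrite (_ : D * r ^+ 2 / _ * _ = 2 * D * r ^+ 2 / (t%:R + 1 - 2^-1) ^+ 2 +
   D * (l / (2 * t%:R + 1)) ^+ 2 * r ^+ 2 / 2); last first.
  by field; rewrite gt_eqF// ltr_wpDl// mulr_ge0.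
have DR : 0 <= 2 * D * r ^+ 2 by rewrite mulr_ge0 ?sqr_ge0// mulr_ge0.
rewrite lerD2r ler_wpM2l//.
by rewrite lef_pV2 ?posrE ?exprn_gt0// ?lerXn2r ?nnegrE; lra.
Qed.

(** Order 2 already contains a kernel vector of [M], so [gap_nonconvex] applies with [eps = 0]. *)
Lemma gap_small_dim y : dot y y <= r ^+ 2 -> b != 0 ->
  (0 < t)%N -> (d <= 1)%N -> (d == 1%N -> dot u b != 0) ->
  quad A b s - quad A b y <= 2 * D * r ^+ 2 / t.+2%:R ^+ 2.
Proof.
move=> yr b0 t0 d1 d1u.
have [e [f [z0 Mz]]] := small_dim_kernel (shift_sym As) shift_eigen0 uu b0 d1 d1u.
set z := e *: b + _ in z0 Mz.
have zK : z \in krylov A b t.+1.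
  rewrite rpredD// rpredZ//; first exact: krylov_base.
  by apply: (@krylovW _ _ _ _ 2); rewrite ?krylov_mul_shift ?krylov_base.
have := gap_nonconvex As r0 smin lo0 yr zK z0 (lexx 0).
by rewrite Mz dot0r mul0r => /(_ (lexx 0)); rewrite !mul0r addr0.
Qed.

(** With [z = b] and [eps = D], both terms of [gap_nonconvex] equal D r^2/2. *)
Lemma gap_one_step y : dot y y <= r ^+ 2 -> b != 0 -> t = 0%N ->
  quad A b s - quad A b y <= D * r ^+ 2.
Proof.
move=> yr b0 t0; have D0 := spread_ge0 As.
apply: le_trans (gap_nonconvex As r0 smin lo0 yr _ b0 D0 (shift_le As b)) _.
  exact: krylov_base.
by rewrite t0 -/D le_eqVlt; apply/orP; left; apply/eqP; field.
Qed.

End GapBounds.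

Lemma log_factor_le (R : realType) (X : R) : 0 < X -> 1 <= 16 * X ->
  0 <= ln (16 * X) /\ 2 + ln (16 * X) ^+ 2 / 8 <= 4 + 1 / 2 * ln X ^+ 2.
Proof.
move=> X0 X1; split; first exact: ln_ge0.
rewrite lnM ?posrE//; set h := ln 16; set L := ln X.
have h3 : h <= 3.
  by rewrite -(@expRK R 3) ler_ln ?posrE ?expR_gt0// expR3_ge16.
have h0 : 0 <= h by rewrite ln_ge0//; lra.
have h9 : h ^+ 2 <= 9 by rewrite (_ : 9 = 3 ^+ 2) ?lerXn2r ?nnegrE//; ring.
(* The right side minus the left is (3/8)(L - h/3)^2 + 2 - h^2/6. *)
have := sqr_ge0 (L - h / 3); nra.
Qed.

(** * Rotation-invariant integrals over the sphere *)

Section Borel.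
Variables (R : realType) (d : nat).

Notation B := (borel_cV R d).

Lemma open_borel (U : set 'cV[R]_d) : open U -> measurable (U : set B).
Proof. by move=> oU; exact: sub_sigma_algebra. Qed.

Lemma continuous_borel (f : 'cV[R]_d -> R) :
  continuous f -> measurable_fun setT (f : B -> R).
Proof.
move=> /continuousP cf; apply: (measurability _ (measurable_realfun.RGenOpens.measurableE R)).
move=> _ [_ [a [b ->]] <-]; rewrite setTI; apply: open_borel; apply: cf.
exact: interval_open.
Qed.

Lemma continuous_borel_cV (f : 'cV[R]_d -> 'cV[R]_d) :
  continuous f -> measurable_fun setT (f : B -> B).
Proof.
move=> /continuousP cf; apply: (@measurability _ _ B B setT f _ erefl).
by move=> _ [U oU <-]; rewrite setTI; apply: open_borel; exact: cf.
Qed.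

Lemma coord_cV_continuous (i : 'I_d) : continuous (fun x : 'cV[R]_d => x i 0).
Proof. exact: coord_continuous. Qed.

Lemma cV_continuous (T : topologicalType) (f : T -> 'cV[R]_d) :
  (forall i, continuous (fun x => f x i 0)) -> continuous f.
Proof.
move=> cf x P [Q Qn QP]; apply: (@filterS _ (nbhs x) _ _ _ (fun y => QP (f y))).
apply: filter_forall => i; apply: filter_forall => j.
by move: (Qn i j); rewrite !ord1 => Qi; exact: (cf i x).
Qed.

Lemma continuous_add_fun (T : topologicalType) (f g : T -> R) :
  continuous f -> continuous g -> continuous (fun x => f x + g x).
Proof. by move=> cf cg x; apply: (@cvgD _ _ _ (nbhs x) _ f g _ _ (cf x) (cg x)). Qed.

Lemma continuous_mul_fun (T : topologicalType) (f g : T -> R) :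
  continuous f -> continuous g -> continuous (fun x => f x * g x).
Proof. by move=> cf cg x; apply: (@cvgM _ _ (nbhs x) _ f g _ _ (cf x) (cg x)). Qed.

Lemma continuous_sum_fun (T : topologicalType) n (f : 'I_n -> T -> R) :
  (forall i, continuous (f i)) -> continuous (fun x => \sum_i f i x).
Proof.
by move=> cf; apply: continuous_big => [|i _]; [exact: add_continuous | exact: cf].
Qed.

Lemma dot_continuous (u : 'cV[R]_d) : continuous (fun x => dot u x).
Proof.
rewrite (_ : (fun _ => _) = fun x : 'cV[R]_d => \sum_i u i 0 * x i 0).
  apply: continuous_sum_fun => i; apply: continuous_mul_fun.
    exact: cst_continuous.
  exact: coord_cV_continuous.
by apply/funext => x; rewrite dotE.
Qed.

Lemma mulmx_cV_continuous (Q : 'M[R]_d) : continuous (fun x : 'cV[R]_d => Q *m x).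
Proof.
apply: cV_continuous => i.
rewrite (_ : (fun _ => _) = dot (row i Q)^T); first exact: dot_continuous.
by apply/funext => x; rewrite /dot trmxK -row_mul [RHS]mxE.
Qed.

Lemma dotxx_continuous : continuous (fun x : 'cV[R]_d => dot x x).
Proof.
rewrite (_ : (fun _ => _) = fun x : 'cV[R]_d => \sum_i x i 0 * x i 0).
  by apply: continuous_sum_fun => i; apply: continuous_mul_fun; exact: coord_cV_continuous.
by apply/funext => x; rewrite dotE.
Qed.

Lemma sphereE : [set x : 'cV[R]_d | enorm x = 1] = [set x | dot x x = 1].
Proof.
apply/seteqP; split => x /= h; first by rewrite -enorm_sqr h expr1n.
by rewrite enorm_sqrt h sqrtr1.
Qed.

Lemma sphere_borel : measurable ([set x | dot x x = 1] : set B).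
Proof.
have := continuous_borel dotxx_continuous.
by move=> /(_ measurableT [set 1] (measurable_set1 _)); rewrite setTI.
Qed.

End Borel.

(** * Plane rotations and reflections *)

Section Rotations.
Variables (R : realType) (d : nat).
Implicit Types (p q u x y : 'cV[R]_d.+1) (Q : 'M[R]_d.+1).

Lemma outer_mulmx p q x : p *m q^T *m x = dot q x *: p.
Proof. by rewrite -mulmxA [q^T *m x]mx11_scalar mul_mx_scalar. Qed.

Lemma delta_dot i x : dot (delta_mx i 0) x = x i 0.
Proof.
rewrite dotE (bigD1 i)//= big1 ?addr0; first by rewrite mxE !eqxx mul1r.
by move=> j ji; rewrite mxE (negbTE ji) mul0r.
Qed.

Lemma isometry_orthogonal Q :
  (forall x y, dot (Q *m x) (Q *m y) = dot x y) -> Q^T *m Q = 1%:M.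
Proof.
move=> Qd; apply/matrixP => i j.
have := Qd (delta_mx i 0) (delta_mx j 0).
by rewrite dot_mx mulmxA !delta_dot -colE !mxE eqxx andbT.
Qed.

Lemma plane_rotation p q (c e : R) : dot p p = 1 -> dot q q = 1 -> dot p q = 0 ->
  c ^+ 2 + e ^+ 2 = 1 ->
  exists2 Q, Q^T *m Q = 1%:M & forall x, Q *m x = x +
    ((c - 1) * dot p x - e * dot q x) *: p + (e * dot p x + (c - 1) * dot q x) *: q.
Proof.
move=> pp qq pq ce.
pose Q : 'M[R]_d.+1 := 1%:M + (c - 1) *: (p *m p^T) - e *: (p *m q^T)
  + e *: (q *m p^T) + (c - 1) *: (q *m q^T).
have QE x : Q *m x = x +
    ((c - 1) * dot p x - e * dot q x) *: p + (e * dot p x + (c - 1) * dot q x) *: q.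
  rewrite /Q !mulmxDl mulNmx -!scalemxAl !outer_mulmx mul1mx !scalerA.
  by rewrite scalerBl scalerDl !addrA.
exists Q => //; apply: isometry_orthogonal => x y.
rewrite !QE !dot_lin pp qq (dotC q p) pq (dotC x p) (dotC x q).
rewrite [LHS](_ : _ = dot x y + (c ^+ 2 + e ^+ 2 - 1) *
  (dot p x * dot p y + dot q x * dot q y)); last by ring.
by rewrite ce subrr mul0r addr0.
Qed.

(** The reflection exchanging [u] and the first basis vector; through it [dot u x] has the law of
    the first coordinate. *)
Lemma householder u : dot u u = 1 ->
  exists2 Q : 'M[R]_d.+1, Q^T *m Q = 1%:M &
    forall x : 'cV[R]_d.+1, (Q *m x) 0 0 = dot u x.
Proof.
move=> uu; pose e : 'cV[R]_d.+1 := delta_mx 0 0.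
have ee : dot e e = 1 by rewrite delta_dot mxE.
have [ue|ue] := eqVneq u e.
  exists (1%:M : 'M[R]_d.+1) => [|x]; first by rewrite trmx1 mulmx1.
  by rewrite mul1mx ue delta_dot.
have [w wE] : exists w, w = u - e by exists (u - e).
pose k := 2 / dot w w.
have w0 : dot w w != 0 by rewrite wE dot_eq0 subr_eq0.
have wwE : dot w w = 2 - 2 * dot e u.
  by rewrite wE !dot_lin uu ee (dotC u e); ring.
pose Q : 'M[R]_d.+1 := 1%:M - k *: (w *m w^T).
have QE x : Q *m x = x - (k * dot w x) *: w.
  by rewrite /Q mulmxBl mul1mx -scalemxAl outer_mulmx scalerA.
exists Q => [|x].
  apply: isometry_orthogonal => x y; rewrite !QE !dot_lin (dotC x w).
  rewrite [LHS](_ : _ = dot x y + k * (k * dot w w - 2) * dot w x * dot w y); last by ring.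
  by rewrite /k divfK// subrr mulr0 !mul0r addr0.
rewrite -delta_dot -/e QE wE !dot_lin.
have kE : k * (1 - dot e u) = 1 by rewrite /k wwE; field; rewrite -wwE.
rewrite [dot e u - dot e e](_ : _ = - (1 - dot e u)) ?ee; last by ring.
rewrite [LHS](_ : _ = dot e x + k * (1 - dot e u) * (dot u x - dot e x)); last by ring.
by rewrite kE; ring.
Qed.

End Rotations.

(** * Integrals over the sphere *)

Section SphereIntegral.
Variables (R : realType) (d : nat).
Notation B := (borel_cV R d.+1).
Variable mu : probability B R.
Hypothesis mu_unif : uniform_sphere mu.

Definition sphere : set B := [set x : 'cV[R]_d.+1 | dot x x = 1].

Lemma measurable_sphere : measurable sphere.
Proof. exact: sphere_borel. Qed.

Lemma mu_sphere : mu sphere = 1%E.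
Proof. by rewrite -mu_unif.1; congr (mu _); rewrite sphereE. Qed.

(** Continuity gives Borel measurability, the bound on the sphere integrability; the class is stable
    under sums, products and orthogonal maps. *)
Definition tame (F : 'cV[R]_d.+1 -> R) :=
  continuous F /\ exists K, forall x, sphere x -> `|F x| <= K.

Lemma tame_integrable F : tame F -> mu.-integrable sphere (EFin \o F).
Proof.
move=> [cF [K FK]]; apply: measurable_bounded_integrable.
- exact: measurable_sphere.
- by rewrite (le_lt_trans (probability_le1 _ measurable_sphere))// ltry.
- by apply: measurable_funTS; exact: continuous_borel.
- exists K; split; first exact: num_real.
  by move=> M KM x Sx /=; rewrite (le_trans (FK x Sx))// ltW.
Qed.

Lemma tame_cst c : tame (fun=> c).
Proof. by split; [exact: cst_continuous | exists `|c|]. Qed.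

Lemma tame_add F H : tame F -> tame H -> tame (fun x => F x + H x).
Proof.
move=> [cF [K FK]] [cH [L HL]]; split; first exact: continuous_add_fun.
by exists (K + L) => x Sx; rewrite (le_trans (ler_normD _ _))// lerD ?FK ?HL.
Qed.

Lemma tame_mul F H : tame F -> tame H -> tame (fun x => F x * H x).
Proof.
move=> [cF [K FK]] [cH [L HL]]; split; first exact: continuous_mul_fun.
by exists (K * L) => x Sx; rewrite normrM ler_pM ?FK ?HL.
Qed.

Lemma tame_sub F H : tame F -> tame H -> tame (fun x => F x - H x).
Proof.
move=> tF tH; rewrite (_ : (fun _ => _) = fun x => F x + (-1) * H x).
  by apply: tame_add => //; apply: tame_mul => //; exact: tame_cst.
by apply/funext => x; rewrite mulN1r.
Qed.

Lemma tame_sum n (F : 'I_n -> 'cV[R]_d.+1 -> R) :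
  (forall i, tame (F i)) -> tame (fun x => \sum_i F i x).
Proof.
move=> tF; split; first by apply: continuous_sum_fun => i; exact: (tF i).1.
have /choice[K FK] i : exists K, forall x, sphere x -> `|F i x| <= K.
  exact: (tF i).2.
exists (\sum_i K i) => x Sx.
by rewrite (le_trans (ler_norm_sum _ _ _))// ler_sum// => i _; exact: FK.
Qed.

Lemma coord_le1 i (x : 'cV[R]_d.+1) : sphere x -> `|x i 0| <= 1.
Proof.
move=> Sx; rewrite -(@ler_pXn2r _ 2)// ?nnegrE// expr1n real_normK ?num_real//.
rewrite -[leRHS]Sx dotE (bigD1 i)//= -expr2 lerDl.
by apply: sumr_ge0 => j _; rewrite -expr2 sqr_ge0.
Qed.

Lemma tame_coord i : tame (fun x => x i 0).
Proof.
by split; [exact: coord_cV_continuous | exists 1 => x; exact: coord_le1].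
Qed.

Lemma tame_sqr_coord i : tame (fun x => x i 0 ^+ 2).
Proof.
rewrite (_ : (fun _ => _) = fun x : 'cV[R]_d.+1 => x i 0 * x i 0).
  by apply: tame_mul; exact: tame_coord.
by apply/funext => x; rewrite expr2.
Qed.

Lemma tame_comp (G : R -> R) F : continuous G ->
  (exists K, forall a, `|a| <= 1 -> `|G a| <= K) ->
  continuous F -> (forall x, sphere x -> `|F x| <= 1) -> tame (G \o F).
Proof.
move=> cG [K GK] cF F1; split; last by exists K => x Sx; exact/GK/F1.
by move=> x; apply: continuous_comp; [exact: cF | exact: cG].
Qed.

Lemma sphere_orthogonal (Q : 'M[R]_d.+1) x : Q^T *m Q = 1%:M ->
  sphere (Q *m x) = sphere x.
Proof. by move=> QQ; rewrite /sphere/= dot_mx mulmxA QQ mul1mx. Qed.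

Lemma tame_mulmx (Q : 'M[R]_d.+1) F : Q^T *m Q = 1%:M -> tame F ->
  tame (fun x => F (Q *m x)).
Proof.
move=> QQ [cF [K FK]]; split.
  move=> x; apply: (@continuous_comp _ _ _ (mulmx Q) F); last exact: cF.
  exact: mulmx_cV_continuous.
by exists K => x Sx; apply: FK; rewrite sphere_orthogonal.
Qed.

Lemma integral_orthogonal (Q : 'M[R]_d.+1) F : Q^T *m Q = 1%:M -> tame F ->
  (\int[mu]_(x in sphere) F (Q *m x) = \int[mu]_(x in sphere) F x)%R.
Proof.
move=> QQ tF; have mQ : measurable_fun setT (mulmx Q : B -> B).
  by apply: continuous_borel_cV; exact: mulmx_cV_continuous.
have preS : mulmx Q @^-1` sphere = sphere.
  by apply/seteqP; split => x /=; rewrite sphere_orthogonal.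
rewrite /Rintegral; congr fine; apply/esym.
rewrite (eq_measure_integral (pushforward mu (mulmx Q : B -> B))); last first.
  by move=> A mA _; apply/esym; exact: mu_unif.2.
rewrite integral_pushforward ?preS//.
- by apply/measurable_realfun.measurable_EFinP; exact: continuous_borel tF.1.
- exact: tame_integrable (tame_mulmx QQ tF).
- exact: measurable_sphere.
Qed.

Lemma norm_integral_le F K : tame F -> (forall x, sphere x -> `|F x| <= K) ->
  `|\int[mu]_(x in sphere) F x|%R <= K.
Proof.
move=> tF FK; have mS := measurable_sphere.
have iF := tame_integrable tF.
have iK := tame_integrable (tame_cst K).
have iNK := tame_integrable (tame_cst (- K)).
have cst c : (\int[mu]_(x in sphere) c)%R = c.
  by rewrite Rintegral_cst//; transitivity (c * fine 1%E); [congr (_ * fine _); exact: mu_sphere | rewrite mulr1].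
rewrite ler_norml -{1}[- K]cst -{2}[K]cst; apply/andP; split.
  by apply: le_Rintegral => // x /FK; rewrite ler_norml => /andP[].
by apply: le_Rintegral => // x /FK; rewrite ler_norml => /andP[].
Qed.

End SphereIntegral.

(** * Stein identity and anti-concentration *)

Section Taylor.
Variable R : realType.
Implicit Types (G H : R -> R) (a b : R).

(** [G1] is the derivative of [G] on [-1, 1], the range of a coordinate, with a uniform quadratic
    remainder; difference quotients can then be bounded under the integral. *)
Definition taylor1 G G1 := exists K, [/\ 0 <= K,
  forall a, `|a| <= 1 -> `|G a| <= K /\ `|G1 a| <= K &
  forall a b, `|a| <= 1 -> `|b| <= 1 ->
    `|G b - G a - G1 a * (b - a)| <= K * (b - a) ^+ 2].

Lemma normM_le a b A B : `|a| <= A -> `|b| <= B -> `|a * b| <= A * B.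
Proof. by move=> aA bB; rewrite normrM ler_pM. Qed.

Lemma normD_le a b A B : `|a| <= A -> `|b| <= B -> `|a + b| <= A + B.
Proof. by move=> aA bB; rewrite (le_trans (ler_normD _ _))// lerD. Qed.

Lemma taylor1_id : taylor1 id (fun=> 1).
Proof.
exists 1; split => // [a a1|a b _ _]; first by rewrite normr1.
by rewrite mul1r subrr normr0 mul1r sqr_ge0.
Qed.

Lemma taylor1_mul G G1 H H1 : taylor1 G G1 -> taylor1 H H1 ->
  taylor1 (fun a => G a * H a) (fun a => G1 a * H a + G a * H1 a).
Proof.
move=> [K [K0 GK GT]] [L [L0 HL HT]].
exists (K * L * 5); split => [|a a1|a b a1 b1].
- by rewrite !mulr_ge0.
- have [Ga G1a] := GK a a1; have [Ha H1a] := HL a a1.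
  have KL : 0 <= K * L by rewrite mulr_ge0.
  split; first by apply: le_trans (normM_le Ga Ha) _; lra.
  by apply: le_trans (normD_le (normM_le G1a Ha) (normM_le Ga H1a)) _; lra.
have [Ga G1a] := GK a a1; have [Ha H1a] := HL a a1; have [Hb _] := HL b b1.
have Ge := GT a b a1 b1; have He := HT a b a1 b1.
set e := (X in `|X| <= _) in Ge; set e' := (X in `|X| <= _) in He.
(* The three terms cost K L, K L and 3 K L, whence the constant 5. *)
rewrite (_ : _ - _ = G1 a * H1 a * (b - a) ^+ 2 + e * H b + e' * (G a + G1 a * (b - a))).
  have ba : `|b - a| <= 1 + 1 by apply: le_trans (ler_normB _ _) _; exact: lerD.
  have b2 : `|(b - a) ^+ 2| <= (b - a) ^+ 2 by rewrite ger0_norm ?sqr_ge0.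
  apply: le_trans (normD_le (normD_le (normM_le (normM_le G1a H1a) b2)
    (normM_le Ge Hb)) (normM_le He (normD_le Ga (normM_le G1a ba)))) _.
  by rewrite le_eqVlt; apply/orP; left; apply/eqP; ring.
by rewrite /e /e'; ring.
Qed.

(** The derivative 1/(1+|a|)^2 of the softsign is Lipschitz across the kink of the absolute value.
    Oddness reduces to [0 <= a]; the remainder is then computed for each sign of [b]. *)
Lemma softsign_taylor a b :
  `|b / (1 + `|b|) - a / (1 + `|a|) - (b - a) / (1 + `|a|) ^+ 2| <= 2 * (b - a) ^+ 2.
Proof.
wlog a0 : a b / 0 <= a => [hw|].
  have [/hw//|a0] := leP 0 a; have := hw (- a) (- b).
  rewrite oppr_ge0 !normrN => /(_ (ltW a0)).
  rewrite (_ : - b / _ - _ - _ = - (b / (1 + `|b|) - a / (1 + `|a|) - (b - a) / (1 + `|a|) ^+ 2)); last by ring.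
  by rewrite normrN (_ : - b - - a = - (b - a)) ?sqrrN//; ring.
rewrite (ger0_norm a0); have a1 : 0 < 1 + a by rewrite ltr_wpDr.
have [b0|b0] := leP 0 b.
  have b1 : 0 < 1 + b by rewrite ltr_wpDr.
  rewrite (ger0_norm b0) (_ : _ - _ = - ((b - a) ^+ 2 * ((1 + a) ^+ 2 * (1 + b))^-1)); last first.
    by field; rewrite !gt_eqF.
  have P1 : 1 <= (1 + a) ^+ 2 * (1 + b).
    have ha : 1 <= 1 + a by lra.
    have hb : 1 <= 1 + b by lra.
    by apply: le_trans hb _; rewrite ler_peMl ?exprn_ege1// ltW.
  have P0 := lt_le_trans ltr01 P1.
  rewrite normrN ger0_norm; last by rewrite mulr_ge0 ?sqr_ge0// invr_ge0 ltW.
  rewrite [leLHS]mulrC ler_wpM2r ?sqr_ge0//.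
  by apply: (@le_trans _ _ 1); [rewrite invf_le1 | lra].
pose e := - b; have e0 : 0 <= e by rewrite oppr_ge0 ltW.
have bE : b = - e by rewrite /e opprK.
clearbody e; rewrite bE normrN (ger0_norm e0).
have e1 : 0 < 1 + e by rewrite ltr_wpDr.
have P0 : 0 < (1 + a) ^+ 2 * (1 + e) by rewrite mulr_gt0 ?exprn_gt0.
rewrite (_ : _ - _ = (e ^+ 2 - 2 * a * e - 2 * a ^+ 2 * e - a ^+ 2) / ((1 + a) ^+ 2 * (1 + e))); last first.
  by field; rewrite !gt_eqF.
rewrite normrM normfV (gtr0_norm P0) ler_pdivrMr// (_ : - e - a = - (a + e)) ?sqrrN; last by ring.
have ae : 0 <= a * e by rewrite mulr_ge0.
have a2 := sqr_ge0 a; have e2 := sqr_ge0 e.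
have aae : 0 <= a ^+ 2 * e by rewrite mulr_ge0.
have P1 : 1 + e <= (1 + a) ^+ 2 * (1 + e) by rewrite ler_peMl ?(ltW e1)// exprn_ege1//; lra.
apply: (@le_trans _ _ (2 * (a + e) ^+ 2 * (1 + e))); last first.
  by rewrite ler_wpM2l// mulr_ge0 ?sqr_ge0.
have eee : 0 <= e ^+ 2 * e by rewrite mulr_ge0.
have aee : 0 <= a * e * e by rewrite mulr_ge0.
rewrite ler_norml; apply/andP; split; rewrite -subr_ge0.
  rewrite (_ : _ - _ = a ^+ 2 + 2 * (a * e) + 3 * e ^+ 2 + 4 * (a * e * e) + 2 * (e ^+ 2 * e)); last by ring.
  by rewrite !addr_ge0// mulr_ge0.
rewrite (_ : _ - _ = 3 * a ^+ 2 + 6 * (a * e) + e ^+ 2 + 4 * (a ^+ 2 * e) + 4 * (a * e * e) + 2 * (e ^+ 2 * e)); last by ring.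
by rewrite !addr_ge0// mulr_ge0.
Qed.

End Taylor.

(** * The test function for the Stein identity *)

Section TestFunction.
Variables (R : realType) (c eta : R).
Hypotheses (c0 : 0 <= c) (eta0 : 0 < eta).

(** A softsign of width [eta] centred at [c]: bounded by 1, with derivative [ramp1] at least 1/(4
    eta) on the slab. *)
Definition ramp (a : R) := (a - c) / eta / (1 + `|(a - c) / eta|).
Definition ramp1 (a : R) := eta^-1 / (1 + `|(a - c) / eta|) ^+ 2.
(** On [-1, 1] this is 1/(e + 1 - a), with derivative its own square; the absolute value makes it
    continuous on the whole line. *)
Definition pole (e a : R) := (e + `|1 - a|)^-1.

Lemma ramp_den_gt0 a : 0 < 1 + `|(a - c) / eta|.
Proof. by rewrite ltr_wpDr. Qed.

Lemma ramp_lt1 a : `|ramp a| < 1.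
Proof.
rewrite /ramp normrM normfV (gtr0_norm (ramp_den_gt0 a)).
by rewrite ltr_pdivrMr ?ramp_den_gt0// mul1r ltrDr.
Qed.

Lemma ramp1_bounds a : 0 <= ramp1 a <= eta^-1.
Proof.
have h : 1 <= (1 + `|(a - c) / eta|) ^+ 2 by rewrite exprn_ege1// lerDl.
have h0 := lt_le_trans ltr01 h; have e0 : 0 <= eta^-1 by rewrite invr_ge0 ltW.
rewrite /ramp1; apply/andP; split; first by rewrite divr_ge0// ltW.
by rewrite ler_pdivrMr// ler_peMr.
Qed.

Lemma taylor1_ramp : taylor1 ramp ramp1.
Proof.
have e0 : 0 <= eta^-1 by rewrite invr_ge0 ltW.
exists (1 + eta^-1 + 2 * eta^-1 ^+ 2); split => [|a _|a b _ _].
- by rewrite !addr_ge0// mulr_ge0// sqr_ge0.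
- have E : 0 <= 2 * eta^-1 ^+ 2 by rewrite mulr_ge0// sqr_ge0.
  split; first by rewrite (le_trans (ltW (ramp_lt1 a)))//; lra.
  have /andP[h h'] := ramp1_bounds a; rewrite ger0_norm// (le_trans h')//; lra.
have := softsign_taylor ((a - c) / eta) ((b - c) / eta).
rewrite (_ : (b - c) / eta - (a - c) / eta = (b - a) / eta); last by field; rewrite gt_eqF.
rewrite -/(ramp a) -/(ramp b) (_ : _ / eta / _ = ramp1 a * (b - a)); last by rewrite /ramp1; ring.
move=> h; apply: le_trans h _; rewrite exprMn.
rewrite -subr_ge0 (_ : _ - _ = (1 + eta^-1) * (b - a) ^+ 2); last by ring.
by rewrite mulr_ge0 ?sqr_ge0// addr_ge0.
Qed.

Lemma taylor1_pole e : 0 < e -> taylor1 (pole e) (fun a => pole e a ^+ 2).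
Proof.
move=> e0; have e1 : 0 < e^-1 by rewrite invr_gt0.
have poleE a : `|a| <= 1 -> pole e a = (e + (1 - a))^-1.
  by rewrite ler_norml => /andP[_ a1]; rewrite /pole ger0_norm ?subr_ge0.
have den a : `|a| <= 1 -> e <= e + (1 - a).
  by rewrite ler_norml => /andP[_ a1]; rewrite lerDl subr_ge0.
have poleB a : `|a| <= 1 -> 0 <= pole e a <= e^-1.
  move=> a1; have := den a a1; rewrite poleE// => h.
  have h0 := lt_le_trans e0 h.
  by rewrite invr_ge0 ltW//= lef_pV2.
exists (e^-1 + e^-1 ^+ 2 + e^-1 ^+ 3); split => [|a a1|a b a1 b1].
- by rewrite !addr_ge0 ?exprn_ge0// ltW.
- have /andP[p0 p1] := poleB a a1.
  have h2 : pole e a ^+ 2 <= e^-1 ^+ 2 by rewrite lerXn2r// nnegrE ltW.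
  have g2 : 0 < e^-1 ^+ 2 by rewrite exprn_gt0.
  have g3 : 0 < e^-1 ^+ 3 by rewrite exprn_gt0.
  by rewrite !ger0_norm ?sqr_ge0//; split; lra.
rewrite (_ : _ - _ = pole e a ^+ 2 * pole e b * (b - a) ^+ 2); last first.
  rewrite !poleE//; field.
  by rewrite !gt_eqF// (lt_le_trans e0) ?den.
have /andP[p0 p1] := poleB a a1; have /andP[q0 q1] := poleB b b1.
have nn : 0 <= pole e a ^+ 2 * pole e b * (b - a) ^+ 2.
  by rewrite mulr_ge0 ?sqr_ge0// mulr_ge0 ?sqr_ge0.
rewrite (ger0_norm nn) ler_wpM2r ?sqr_ge0//.
apply: (@le_trans _ _ (e^-1 ^+ 3)).
  by rewrite [leRHS]exprSr ler_pM ?sqr_ge0// lerXn2r// nnegrE ltW.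
by rewrite lerDr addr_ge0 ?sqr_ge0// ltW.
Qed.

Lemma continuous_inv_fun (f : R -> R) : continuous f -> (forall a, f a != 0) ->
  continuous (fun a => (f a)^-1).
Proof. by move=> cf f0 a; apply: cvgV; [exact: f0 | exact: cf]. Qed.

Lemma continuous_norm_fun (f : R -> R) : continuous f -> continuous (fun a => `|f a|).
Proof. by move=> cf a; apply: cvg_norm; exact: cf. Qed.

Lemma continuous_aff (p q : R) : continuous (fun a : R => p * a + q).
Proof.
apply: continuous_add_fun; last exact: cst_continuous.
by apply: continuous_mul_fun; [exact: cst_continuous | move=> x; exact: cvg_id].
Qed.

Lemma ramp_den_continuous : continuous (fun a => 1 + `|(a - c) / eta|).
Proof.
apply: continuous_add_fun; first exact: cst_continuous.
apply: continuous_norm_fun.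
rewrite (_ : (fun _ => _) = fun a => eta^-1 * a + - c / eta); first exact: continuous_aff.
by apply/funext => a; ring.
Qed.

Lemma ramp_continuous : continuous ramp.
Proof.
apply: (@continuous_mul_fun _ R (fun a => (a - c) / eta)).
  rewrite (_ : (fun _ => _) = fun a => eta^-1 * a + - c / eta); first exact: continuous_aff.
  by apply/funext => a; ring.
apply: continuous_inv_fun; first exact: ramp_den_continuous.
by move=> a; rewrite gt_eqF// ramp_den_gt0.
Qed.

Lemma ramp1_continuous : continuous ramp1.
Proof.
apply: (@continuous_mul_fun _ R (fun=> eta^-1)); first exact: cst_continuous.
apply: continuous_inv_fun; last by move=> a; rewrite gt_eqF// exprn_gt0// ramp_den_gt0.
rewrite (_ : (fun _ => _) = fun a => (1 + `|(a - c) / eta|) * (1 + `|(a - c) / eta|)).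
  by apply: continuous_mul_fun; exact: ramp_den_continuous.
by apply/funext => a; rewrite expr2.
Qed.

Lemma pole_continuous e : 0 < e -> continuous (pole e).
Proof.
move=> e0; apply: continuous_inv_fun; last by move=> a; rewrite gt_eqF// ltr_wpDr.
apply: continuous_add_fun; first exact: cst_continuous.
apply: continuous_norm_fun.
rewrite (_ : (fun _ => _) = fun a => -1 * a + 1); first exact: continuous_aff.
by apply/funext => a; ring.
Qed.

Lemma ramp1_ge a : `|a - c| <= eta -> (4 * eta)^-1 <= ramp1 a.
Proof.
move=> ac; have y1 : `|(a - c) / eta| <= 1.
  by rewrite normrM normfV (gtr0_norm eta0) ler_pdivrMr// mul1r.
rewrite /ramp1 invfM mulrC ler_wpM2l// ?invr_ge0 ?(ltW eta0)//.
rewrite lef_pV2 ?posrE ?exprn_gt0 ?ramp_den_gt0//.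
have := normr_ge0 ((a - c) / eta); nra.
Qed.

(* [ramp - 5/4] times [pole e]: the ramp charges the slab around c; near a = 1,
   where the weight 1 - a^2 degenerates, the pole just beyond 1 takes over. *)
Lemma test_function_bound (n a : R) : 2 <= n -> eta <= 1 / 16 -> `|a| <= 1 ->
  let e := eta / 12 in
  let Phi := (1 - a ^+ 2) * (ramp1 a * pole e a + (ramp a - 5 / 4) * pole e a ^+ 2)
    - n * a * ((ramp a - 5 / 4) * pole e a) in
  - (9 / 4) * (1 + n * `|a|) <= Phi /\
  (`|a - c| <= eta -> 3 / (16 * eta) - 9 / 4 * (1 + n * `|a|) <= Phi).
Proof.
move=> n2 eta1 a1 e.
have e0 : 0 < e by rewrite divr_gt0.
have /andP[S0 _] := ramp1_bounds a.
have S1 := ramp1_ge (a := a); move: (ramp1 a) S0 S1 => S S0 S1.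
have := ramp_lt1 a; move: (ramp a) => s; rewrite ltr_norml => /andP[s1 s2].
(* The shift 5/4 keeps the factor away from 0, with 1/4 <= q <= 9/4. *)
pose q := 5 / 4 - s; have q1 : 1 / 4 <= q by rewrite /q; lra.
have q2 : q <= 9 / 4 by rewrite /q; lra.
have -> : s - 5 / 4 = - q by rewrite /q; ring.
clearbody q; clear s s1 s2.
have q0 : 0 <= q by lra.
move: (a1); rewrite ler_norml => /andP[an1 a1'].
have w0 : 0 <= 1 - a by rewrite subr_ge0.
rewrite /pole (ger0_norm w0).
have D0 : 0 < e + (1 - a) by rewrite ltr_pwDl.
set D := e + (1 - a) in D0 *.
have DN : D != 0 by rewrite gt_eqF.
have DV : 0 < D^-1 by rewrite invr_gt0.
have a2 : 0 <= 1 - a ^+ 2.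
  by rewrite (_ : _ - _ = (1 - a) * (1 + a)) ?mulr_ge0//; [lra | ring].
have SD : 0 <= (1 - a ^+ 2) * S / D by rewrite divr_ge0 ?mulr_ge0// ltW.
have nna : 0 <= n * `|a| by rewrite mulr_ge0//; lra.
have sE : 3 / (16 * eta) = 3 / 4 * (4 * eta)^-1 by field; rewrite gt_eqF.
have slab x : 3 / 4 <= x -> `|a - c| <= eta -> 3 / (16 * eta) <= x * S.
  move=> x34 ac; rewrite sE; apply: ler_pM => //; last exact: S1.
  by rewrite invr_ge0 mulr_ge0// ltW.
have [a0|a0] := leP 0 a.
- pose rest := q * (2 * a * e) / D ^+ 2.
  have rest0 : 0 <= rest by rewrite divr_ge0 ?sqr_ge0// mulr_ge0// mulr_ge0 ?(ltW e0)// mulr_ge0.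
  have wD : (1 - a) ^+ 2 / D ^+ 2 <= 1.
    rewrite ler_pdivrMr ?exprn_gt0// mul1r lerXn2r ?nnegrE ?(ltW D0)//.
    by rewrite /D lerDr ltW.
  have qwD : q * ((1 - a) ^+ 2 / D ^+ 2) <= 9 / 4.
    have w2 : 0 <= (1 - a) ^+ 2 / D ^+ 2 by rewrite divr_ge0 ?sqr_ge0.
    by rewrite -[9 / 4]mulr1 ler_pM//; lra.
  have naq : 0 <= (n - 2) * a * (q / D) by rewrite !mulr_ge0 ?(ltW DV)// subr_ge0.
  (* Splitting n = 2 + (n - 2), the part with 2 absorbs 2a(1-a) from 1 - a^2 = (1-a)^2 + 2a(1-a) and
     leaves the positive [rest]. *)
  have PhiE : (1 - a ^+ 2) * (S / D + - q * D^-1 ^+ 2) - n * a * (- q / D) =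
     (1 - a ^+ 2) * S / D + rest - q * ((1 - a) ^+ 2 / D ^+ 2) + (n - 2) * a * (q / D).
    by rewrite /rest /D; field.
  rewrite PhiE; split; first by lra.
  move=> ac; suff : 3 / (16 * eta) <= (1 - a ^+ 2) * S / D + rest by lra.
  (* Away from 1, D <= (4/3)(1 - a) and the ramp suffices. Within 3e of 1, D <= 4e and [rest] is at
     least 1/(64 e), which is 3/(16 eta) for e = eta/12. *)
  have [w3|w3] := leP (3 * e) (1 - a).
    apply: (@le_trans _ _ ((1 - a ^+ 2) * S / D)); last by rewrite lerDl.
    rewrite mulrAC; apply: slab => //; rewrite ler_pdivlMr//.
    rewrite (_ : 1 - a ^+ 2 = (1 - a) * (1 + a)); last by ring.
    by apply: (@le_trans _ _ (1 - a)); [rewrite /D; lra | rewrite ler_peMr//; lra].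
  apply: (@le_trans _ _ rest); last by rewrite lerDr.
  rewrite /rest ler_pdivlMr ?exprn_gt0//.
  apply: (@le_trans _ _ (3 / (16 * eta) * (4 * e) ^+ 2)).
    rewrite ler_wpM2l ?divr_ge0// ?mulr_ge0 ?(ltW eta0)// lerXn2r ?nnegrE ?(ltW D0)//; rewrite /D; lra.
  rewrite (_ : _ * _ = 1 / 4 * (2 * (1 / 2) * e)); last by rewrite /e; field; rewrite gt_eqF.
  apply: ler_pM => //; first by lra.
  by rewrite ler_wpM2r ?(ltW e0)// ler_wpM2l//; rewrite /e in w3; lra.
- have D1 : 1 - a <= D by rewrite /D lerDr ltW.
  have w1 : 1 <= 1 - a by lra.
  have aE : `|a| = - a by rewrite ltr0_norm.
  have V1 : D^-1 <= 1 by rewrite invf_le1// (le_trans w1).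
  have t1 : q * (n * `|a| / D) <= 9 / 4 * (n * `|a|).
    apply: ler_pM => //; last by rewrite ler_piMr.
    by rewrite divr_ge0 ?(ltW D0).
  have t2 : q * ((1 - a ^+ 2) / D ^+ 2) <= 9 / 4.
    rewrite -[9 / 4]mulr1; apply: ler_pM => //; first by rewrite divr_ge0 ?sqr_ge0.
    rewrite ler_pdivrMr ?exprn_gt0// mul1r; apply: (@le_trans _ _ (1 * 1)).
      by have := sqr_ge0 a; lra.
    by rewrite expr2 ler_pM// (le_trans w1).
  have PhiE : (1 - a ^+ 2) * (S / D + - q * D^-1 ^+ 2) - n * a * (- q / D) =
     (1 - a ^+ 2) * S / D - q * ((1 - a ^+ 2) / D ^+ 2) - q * (n * `|a| / D).
    by rewrite aE; field.
  rewrite PhiE; split; first by lra.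
  move=> ac; suff : 3 / (16 * eta) <= (1 - a ^+ 2) * S / D by lra.
  rewrite mulrAC; apply: slab => //; rewrite ler_pdivlMr//.
  (* As [c] is nonnegative, a negative [a] in the slab is at least -1/16, so the weight 1 - a^2 is
     close to 1. *)
  move: (ac); rewrite ler_norml => /andP[h _].
  have a16 : - a <= 1 / 16 by move: h eta1 c0; clear; lra.
  have a256 : a ^+ 2 <= 1 / 256.
    rewrite -sqrrN (_ : 1 / 256 = (1 / 16) ^+ 2); last by field.
    by rewrite lerXn2r// ?nnegrE; lra.
  by rewrite /D /e; lra.
Qed.

End TestFunction.

(** First-order expansion of y G(x) along a plane rotation. The rational parametrization with h =
    tan(theta/2) gives cosine [c] and sine [e], and theta is 2h to first order. *)
Lemma rotation_remainder (R : realType) (K h x y c e x' Gx Gx' G1x : R) :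
  0 < h <= 1 -> c = (1 - h ^+ 2) / (1 + h ^+ 2) -> e = 2 * h / (1 + h ^+ 2) ->
  x' = c * x - e * y -> `|x| <= 1 -> `|y| <= 1 -> `|e * x + c * y| <= 1 ->
  0 <= K -> `|Gx| <= K -> `|G1x| <= K ->
  `|Gx' - Gx - G1x * (x' - x)| <= K * (x' - x) ^+ 2 ->
  `|(e * x + c * y) * Gx' - y * Gx - 2 * h * (x * Gx - y ^+ 2 * G1x)| <= 40 * K * h ^+ 2.
Proof.
move=> /andP[h0 h1] cE eE x'E x1 y1 y'1 K0 GK G1K.
set t := (X in `|X| <= _) => tK; set y' := e * x + c * y in y'1 *.
have hh : 0 < 1 + h ^+ 2 by rewrite ltr_pwDl// sqr_ge0.
have h2 : 0 <= h ^+ 2 by exact: sqr_ge0.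
have hn : `|h| = h by rewrite gtr0_norm.
have hle : h ^+ 2 <= h by rewrite expr2 ler_piMr// ltW.
have h21 : 1 <= 1 + h ^+ 2 by rewrite lerDl.
have hh2 : 0 <= 2 * h ^+ 2 by rewrite mulr_ge0.
have hhh : 0 <= 2 * h by rewrite mulr_ge0 ?ltW.
pose k := 1 - c; pose l := 2 * h - e.
have k2 : `|k| <= 2 * h ^+ 2.
  rewrite (_ : k = 2 * h ^+ 2 / (1 + h ^+ 2)); last by rewrite /k cE; field; rewrite gt_eqF.
  rewrite ger0_norm; last by rewrite divr_ge0 ?(ltW hh).
  by rewrite ler_pdivrMr// ler_peMr.
have l2 : `|l| <= 2 * h ^+ 2.
  rewrite (_ : l = 2 * h ^+ 2 * (h / (1 + h ^+ 2))); last by rewrite /l eE; field; rewrite gt_eqF.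
  have q0 : 0 <= h / (1 + h ^+ 2) by rewrite divr_ge0 ?ltW.
  rewrite ger0_norm; last by rewrite mulr_ge0.
  by rewrite ler_piMr// ler_pdivrMr// mul1r; lra.
have e2 : `|e| <= 2 * h.
  rewrite eE ger0_norm; last by rewrite divr_ge0 ?(ltW hh).
  by rewrite ler_pdivrMr// ler_peMr.
have cE' : c = 1 - k by rewrite /k; ring.
have eE' : e = 2 * h - l by rewrite /l; ring.
clearbody k l.
have kN : `|- k| <= 2 * h ^+ 2 by rewrite normrN.
have eN : `|- e| <= 2 * h by rewrite normrN.
have dx : `|x' - x| <= 4 * h.
  rewrite (_ : x' - x = - k * x + - e * y); last by rewrite x'E cE'; ring.
  by apply: le_trans (normD_le (normM_le kN x1) (normM_le eN y1)) _; lra.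
have dy : `|y' - y| <= 4 * h.
  rewrite (_ : y' - y = e * x + - k * y); last by rewrite /y' cE'; ring.
  by apply: le_trans (normD_le (normM_le e2 x1) (normM_le kN y1)) _; lra.
have Kh : 0 <= K * h ^+ 2 by rewrite mulr_ge0.
have tK' : `|t| <= 16 * (K * h ^+ 2).
  apply: le_trans tK _; rewrite (_ : 16 * _ = K * (4 * h) ^+ 2); last by ring.
  rewrite ler_wpM2l// -[leLHS]ger0_norm ?sqr_ge0// normrX lerXn2r ?nnegrE//.
  by rewrite mulr_ge0 ?ltW.
rewrite (_ : _ - _ = (- l * x + - k * y) * Gx + (y * (- k * x + l * y) + (y' - y) * (x' - x)) * G1x + y' * t); last first.
  by rewrite /t /y' x'E cE' eE'; ring.
have lN : `|- l| <= 2 * h ^+ 2 by rewrite normrN.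
apply: le_trans (normD_le (normD_le
  (normM_le (normD_le (normM_le lN x1) (normM_le kN y1)) GK)
  (normM_le (normD_le (normM_le y1 (normD_le (normM_le kN x1) (normM_le l2 y1)))
    (normM_le dy dx)) G1K)) (normM_le y'1 tK')) _.
by rewrite le_eqVlt; apply/orP; left; apply/eqP; ring.
Qed.

(** * The Stein identity on the sphere *)

Section Stein.
Variables (R : realType) (d : nat).
Notation B := (borel_cV R d.+1).
Variable mu : probability B R.
Hypothesis mu_unif : uniform_sphere mu.
Local Notation sphere := (@sphere R d).
Local Notation I f := (\int[mu]_(x in sphere) f x)%R.

Lemma integralB_tame (F H : 'cV[R]_d.+1 -> R) : tame F -> tame H ->
  I (fun x => F x - H x) = I F - I H.
Proof.
by move=> tF tH; apply: RintegralB;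
  [exact: measurable_sphere | exact: tame_integrable | exact: tame_integrable].
Qed.

Lemma integralD_tame (F H : 'cV[R]_d.+1 -> R) : tame F -> tame H ->
  I (fun x => F x + H x) = I F + I H.
Proof.
by move=> tF tH; apply: RintegralD;
  [exact: measurable_sphere | exact: tame_integrable | exact: tame_integrable].
Qed.

Lemma integralZ_tame a (F : 'cV[R]_d.+1 -> R) : tame F ->
  I (fun x => a * F x) = a * I F.
Proof.
by move=> tF; apply: RintegralZl; [exact: measurable_sphere | exact: tame_integrable].
Qed.

Lemma integral_cst_tame a : I (fun=> a) = a.
Proof.
rewrite Rintegral_cst//; last exact: measurable_sphere.
transitivity (a * fine 1%E); last by rewrite mulr1.
by congr (_ * fine _); exact: mu_sphere.
Qed.

Lemma integral_sum_tame n (F : 'I_n -> 'cV[R]_d.+1 -> R) :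
  (forall i, tame (F i)) -> (forall i, I (F i) = 0) ->
  I (fun x => \sum_i F i x) = 0.
Proof.
elim: n F => [|n IH] F tF F0.
  rewrite -[RHS](integral_cst_tame 0); congr (Rintegral _ _ _).
  by apply/funext => x; rewrite big_ord0.
rewrite (_ : (fun _ => _) = fun x => F ord0 x + \sum_(i < n) F (lift ord0 i) x).
  rewrite integralD_tame ?F0 ?add0r ?IH//.
  exact: tame_sum.
by apply/funext => x; rewrite big_ord_recl.
Qed.

Variables (G G1 : R -> R).
Hypotheses (cG : continuous G) (cG1 : continuous G1) (GT : taylor1 G G1).

Lemma tame_G : tame (fun x : 'cV[R]_d.+1 => G (x 0 0)).
Proof.
apply: tame_comp => //; last exact: coord_le1.
  by have [K [_ GK _]] := GT; exists K => a /GK[].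
exact: coord_cV_continuous.
Qed.

Lemma tame_G1 : tame (fun x : 'cV[R]_d.+1 => G1 (x 0 0)).
Proof.
apply: tame_comp => //; last exact: coord_le1.
  by have [K [_ GK _]] := GT; exists K => a /GK[].
exact: coord_cV_continuous.
Qed.

Let Psi (i : 'I_d.+1) (x : 'cV[R]_d.+1) := x 0 0 * G (x 0 0) - x i 0 ^+ 2 * G1 (x 0 0).

Lemma tame_Psi i : tame (Psi i).
Proof.
by apply: tame_sub; apply: tame_mul;
  [exact: tame_coord|exact: tame_G|exact: tame_sqr_coord|exact: tame_G1].
Qed.

(* Derivative at angle 0 of the integral of x_i G(x_0) along the rotations in
   the plane of the coordinates 0 and i. *)
Lemma stein_pair i : i != 0 -> I (Psi i) = 0.
Proof.
move=> i0; have [K [K0 GK GK2]] := GT.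
pose F (x : 'cV[R]_d.+1) := x i 0 * G (x 0 0).
have tF : tame F by apply: tame_mul; [exact: tame_coord | exact: tame_G].
(* Invariance makes the integrals of [F] and of [F] after the rotation equal, so 2h times the
   integral of [Psi i] is within the remainder 40 K h^2 of 0. *)
have small h : 0 < h <= 1 -> `|I (Psi i)| <= 20 * K * h.
  move=> h01; have /andP[h0 h1] := h01.
  pose c := (1 - h ^+ 2) / (1 + h ^+ 2); pose e := 2 * h / (1 + h ^+ 2).
  have hh : 0 < 1 + h ^+ 2 by rewrite ltr_pwDl// sqr_ge0.
  have ce : c ^+ 2 + e ^+ 2 = 1 by rewrite /c /e; field; rewrite gt_eqF.
  pose p : 'cV[R]_d.+1 := delta_mx 0 0; pose q : 'cV[R]_d.+1 := delta_mx i 0.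
  have pp : dot p p = 1 by rewrite delta_dot mxE.
  have qq : dot q q = 1 by rewrite delta_dot mxE !eqxx.
  have pq : dot p q = 0 by rewrite delta_dot mxE eq_sym (negbTE i0).
  have [Q QQ QE] := plane_rotation pp qq pq ce.
  have Q0 (x : 'cV[R]_d.+1) : (Q *m x) 0 0 = c * x 0 0 - e * x i 0.
    by rewrite -(delta_dot 0 (Q *m x)) QE -/p !dot_lin pp pq !delta_dot; ring.
  have Qi (x : 'cV[R]_d.+1) : (Q *m x) i 0 = e * x 0 0 + c * x i 0.
    by rewrite -(delta_dot i (Q *m x)) QE -/q !dot_lin qq (dotC q p) pq !delta_dot; ring.
  have tFQ := tame_mulmx QQ tF; have tP := tame_Psi i.
  have tD : tame (fun x => F (Q *m x) - F x) by exact: tame_sub.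
  have thP : tame (fun x => 2 * h * Psi i x) by apply: tame_mul => //; exact: tame_cst.
  have : `|I (fun x => F (Q *m x) - F x - 2 * h * Psi i x)| <= 40 * K * h ^+ 2.
    apply: norm_integral_le => //; first exact: tame_sub.
    move=> x Sx; have x1 := coord_le1 0 Sx; have y1 := coord_le1 i Sx.
    have SQ : sphere (Q *m x) by rewrite sphere_orthogonal.
    have x'1 := coord_le1 0 SQ; have y'1 := coord_le1 i SQ.
    rewrite Qi in y'1.
    have [Gx G1x] := GK _ x1.
    have := rotation_remainder h01 erefl erefl (Q0 x) x1 y1 y'1 K0 Gx G1x (GK2 _ _ x1 x'1).
    by rewrite /F Qi.
  rewrite (integralB_tame tD thP) (integralB_tame tFQ tF) (integralZ_tame (2 * h) tP).
  rewrite (integral_orthogonal mu_unif QQ tF) subrr sub0r normrN.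
  rewrite normrM gtr0_norm ?mulr_gt0//.
  by rewrite (_ : 40 * K * h ^+ 2 = 2 * h * (20 * K * h)) ?ler_pM2l ?mulr_gt0//; ring.
apply/eqP; rewrite -normr_le0; apply/ler_addgt0Pr => a a0; rewrite add0r.
have K1 : 0 < 20 * K + 1 by lra.
have m0 : 0 < Num.min 1 (a / (20 * K + 1)) <= 1.
  by rewrite lt_min ltr01 divr_gt0// ge_min lexx.
apply: le_trans (small _ m0) _.
apply: (@le_trans _ _ ((20 * K + 1) * (a / (20 * K + 1)))).
  by apply: ler_pM; rewrite ?ge_min ?lexx ?orbT//; [lra | case/andP: m0 => /ltW | lra].
by rewrite mulrC divfK// gt_eqF.
Qed.

(** Sum of [stein_pair] over the [d] coordinates other than 0, whose squares add up to 1 - x_0^2 on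
    the sphere. *)
Lemma stein_identity :
  I (fun x => d%:R * x 0 0 * G (x 0 0) - (1 - x 0 0 ^+ 2) * G1 (x 0 0)) = 0.
Proof.
rewrite -[RHS](integral_sum_tame (fun i : 'I_d => tame_Psi (lift 0 i))) => [|i].
  apply: eq_Rintegral => x; rewrite inE => Sx.
  rewrite sumrB sumr_const card_ord -mulr_suml -[x 0 0 * _ *+ _]mulr_natl mulrA.
  congr (_ - _ * _); rewrite -[1]Sx dotE big_ord_recl -expr2 addrC addKr.
  by apply: eq_bigr => i _; rewrite expr2.
exact: stein_pair.
Qed.

End Stein.

Lemma measurable_slab (R : realType) (c eta : R) :
  measurable [set a : R | `|a - c| <= eta].
Proof.
rewrite (_ : [set _ | _] = `[c - eta, c + eta]%classic); first exact: measurable_itv.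
by apply/seteqP; split => a /=; rewrite in_itv/= ler_distl.
Qed.

(** * Anti-concentration of a coordinate *)

Section AntiConcentration.
Variables (R : realType) (d : nat).
Notation B := (borel_cV R d.+1).
Variable mu : probability B R.
Hypothesis mu_unif : uniform_sphere mu.
Local Notation sphere := (@sphere R d).
Local Notation I f := (\int[mu]_(x in sphere) f x)%R.

Lemma sphere_markov (A : set B) H a : measurable A -> A `<=` sphere -> tame H ->
  (forall x, sphere x -> 0 <= H x) -> (forall x, A x -> a <= H x) ->
  a * fine (mu A) <= I H.
Proof.
move=> mA AS tH H0 HA.
have mS := @measurable_sphere R d; have iH := tame_integrable mu tH.
have iHA : mu.-integrable A (EFin \o H) by apply: (integrableS mS mA AS); exact: iH.
have iA : mu.-integrable A (EFin \o (fun=> a)).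
  by apply: (integrableS mS mA AS); exact: (tame_integrable mu (@tame_cst R d a)).
have mD : measurable (sphere `\` A) by exact: measurableD.
have E : A `|` (sphere `\` A) = sphere by rewrite setDUK.
rewrite -[in leRHS]E Rintegral_setU// ?E//; last first.
  by apply/disj_setPS => x [Ax [_ nAx]].
rewrite -(Rintegral_cst mu mA); apply: (@le_trans _ _ (\int[mu]_(x in A) H x)%R).
  exact: le_Rintegral.
by rewrite lerDl; apply: Rintegral_ge0 => x [Sx _]; exact: H0.
Qed.

Lemma coord_preimage_measurable (i : 'I_d.+1) (Y : set R) : measurable Y ->
  measurable ([set x : 'cV[R]_d.+1 | Y (x i 0)] : set B).
Proof.
move=> mY; have := continuous_borel (@coord_cV_continuous R d.+1 i).
by move=> /(_ measurableT Y mY); rewrite setTI.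
Qed.

Lemma direction_law u (Y : set R) : dot u u = 1 -> measurable Y ->
  mu [set x : 'cV[R]_d.+1 | Y (dot u x)] = mu [set x : 'cV[R]_d.+1 | Y (x 0 0)].
Proof.
move=> uu mY; have [Q QQ Qu] := householder uu.
rewrite -(mu_unif.2 Q QQ _ (coord_preimage_measurable 0 mY)); congr (mu _).
by apply/seteqP; split => x /=; rewrite Qu.
Qed.

Lemma measure_sphereI (A : set B) : measurable A -> mu (A `&` sphere) = mu A.
Proof.
move=> mA; have mS := @measurable_sphere R d.
have S0 : mu (~` sphere) = 0%E.
  have := probability_setC mu mS; rewrite (mu_sphere mu_unif) => ->.
  by rewrite subee.
rewrite -[in RHS](setUIDK A sphere) measureU//; first last.
- by apply/seteqP; split => x //= [[_ Sx] [_ nSx]].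
- exact: measurableD.
- exact: measurableI.
rewrite [X in (_ = _ + X)%E](_ : _ = 0%E) ?adde0//.
apply/eqP; rewrite eq_le measure_ge0 andbT -S0.
by apply: le_measure; rewrite ?inE; [exact: measurableD|exact: measurableC|move=> x []].
Qed.

Let N : R := d.+1%:R.

(** Stein identity for G(a) = a, where the integrand is N x_0^2 - 1. *)
Lemma second_moment : I (fun x => x 0 0 ^+ 2) = N^-1.
Proof.
have cid : continuous (id : R -> R) by move=> x; exact: cvg_id.
have c1 : continuous (fun _ : R => 1 : R) by exact: cst_continuous.
have := stein_identity mu_unif cid c1 (taylor1_id R).
have tx : tame (fun x : 'cV[R]_d.+1 => x 0 0 ^+ 2) by exact: tame_sqr_coord.
rewrite (_ : (fun _ => _) = fun x : 'cV[R]_d.+1 => N * x 0 0 ^+ 2 - 1); last first.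
  by apply/funext => x; rewrite /N /= -natr1; ring.
rewrite (integralB_tame mu) ?(integralZ_tame mu)//; [|by apply: tame_mul => //; exact: tame_cst|exact: tame_cst].
rewrite (integral_cst_tame mu_unif) => /eqP; rewrite subr_eq0 => /eqP h.
by apply: (mulfI (_ : N != 0)); rewrite ?h ?mulfV// /N pnatr_eq0.
Qed.

(** The function of [test_function_bound] is [- St], of mean 0. Adding a majorant of (9/4)(1 +
    d|x_0|) makes it nonnegative and at least 3/(16 eta) on the slab, so Markov's inequality
    applies. *)
Lemma slab_coord c eta : (2 <= d)%N -> 0 <= c -> 0 < eta -> eta <= 1 / 16 ->
  fine (mu [set x : 'cV[R]_d.+1 | `|x 0 0 - c| <= eta /\ sphere x]) <=
  16 * eta * Num.sqrt N.
Proof.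
move=> d2 c0 eta0 eta1.
have n2 : 2 <= d%:R :> R by rewrite ler_nat.
have N0 : 0 < N by rewrite /N ltr0n.
have NE : N = d%:R + 1 by rewrite /N -natr1.
set r := Num.sqrt N; have r0 : 0 < r by rewrite sqrtr_gt0.
have r2 : r ^+ 2 = N by rewrite sqr_sqrtr// ltW.
pose e := eta / 12; have e0 : 0 < e by rewrite divr_gt0.
pose G a := (ramp c eta a - 5 / 4) * pole e a.
pose G1 a := ramp1 c eta a * pole e a + (ramp c eta a - 5 / 4) * pole e a ^+ 2.
have cr : continuous (fun a => ramp c eta a - 5 / 4).
  apply: (@continuous_add_fun _ R (ramp c eta) (fun=> - (5 / 4))).
    exact: ramp_continuous.
  exact: cst_continuous.
have cp := pole_continuous e0.
have cp2 : continuous (fun a => pole e a ^+ 2).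
  rewrite (_ : (fun _ => _) = fun a => pole e a * pole e a).
    exact: continuous_mul_fun.
  by apply/funext => a; rewrite expr2.
have cG : continuous G by exact: continuous_mul_fun.
have cG1 : continuous G1.
  apply: continuous_add_fun; apply: continuous_mul_fun => //.
  exact: ramp1_continuous.
have Tr : taylor1 (fun a => ramp c eta a - 5 / 4) (ramp1 c eta).
  have [K [K0 TK TK2]] := taylor1_ramp c eta0.
  exists (K + 5 / 4); split => [|a a1|a b a1 b1]; first by rewrite addr_ge0.
    have [h1 h2] := TK a a1; split; last by rewrite (le_trans h2)// lerDl.
    by rewrite (le_trans (ler_normB _ _))// lerD// ger0_norm.
  rewrite (_ : _ - _ - _ - _ = ramp c eta b - ramp c eta a - ramp1 c eta a * (b - a)); last by ring.
  apply: le_trans (TK2 a b a1 b1) _.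
  by rewrite ler_wpM2r ?sqr_ge0// lerDl.
have GT : taylor1 G G1 by exact: taylor1_mul Tr (taylor1_pole e0).
pose St (x : 'cV[R]_d.+1) := d%:R * x 0 0 * G (x 0 0) - (1 - x 0 0 ^+ 2) * G1 (x 0 0).
have St0 : I St = 0 by exact: stein_identity.
have tx2 : tame (fun x : 'cV[R]_d.+1 => x 0 0 ^+ 2) by exact: tame_sqr_coord.
have tSt : tame St.
  apply: tame_sub; apply: tame_mul.
  - by apply: tame_mul; [exact: tame_cst | exact: tame_coord].
  - exact: tame_G cG GT.
  - by apply: tame_sub => //; exact: tame_cst.
  - exact: tame_G1 cG1 GT.
pose be := 9 / 4 * (d%:R * r / 2); pose al := 9 / 4 * (1 + d%:R / (2 * r)).
pose H (x : 'cV[R]_d.+1) := (al + be * x 0 0 ^+ 2) - St x.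
have tb : tame (fun x : 'cV[R]_d.+1 => be * x 0 0 ^+ 2).
  by apply: tame_mul => //; exact: tame_cst.
have ta : tame (fun x : 'cV[R]_d.+1 => al + be * x 0 0 ^+ 2).
  by apply: tame_add => //; exact: tame_cst.
have tH : tame H by exact: tame_sub.
have IH : I H = 9 / 4 * (1 + d%:R / r).
  rewrite (integralB_tame mu ta tSt) St0 subr0 (integralD_tame mu (@tame_cst R d al) tb).
  rewrite (integral_cst_tame mu_unif) (integralZ_tame mu be tx2) second_moment -r2.
  by rewrite /al /be; field; rewrite gt_eqF.
(* A quadratic majorant of |a|, tight at |a| = 1/r, so that the second moment 1/r^2 is enough. *)
have amgm a : d%:R * `|a| <= d%:R * r / 2 * a ^+ 2 + d%:R / (2 * r).
  have := sqr_ge0 (r * `|a| - 1); rewrite -(real_normK (num_real a)) => h.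
  rewrite -subr_ge0 (_ : _ - _ = d%:R / (2 * r) * (r * `|a| - 1) ^+ 2).
    by rewrite mulr_ge0// divr_ge0// mulr_ge0// ltW.
  by field; rewrite gt_eqF.
have HB x : sphere x -> 0 <= H x /\ (`|x 0 0 - c| <= eta -> 3 / (16 * eta) <= H x).
  move=> /(coord_le1 0) x1.
  have [h1 h2] := test_function_bound c0 eta0 n2 eta1 x1.
  rewrite -/e in h1 h2; set Phi := (X in _ <= X) in h1; rewrite -/Phi in h2.
  have HE : H x = Phi + 9 / 4 * (1 + (d%:R * r / 2 * x 0 0 ^+ 2 + d%:R / (2 * r))).
    by rewrite /H /al /be /St /Phi /G /G1; ring.
  have xx := amgm (x 0 0); rewrite HE; split; first by lra.
  move=> /h2 {h1 HE}; clearbody Phi; move: xx; clear.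
  move: (3 / (16 * eta)) (d%:R * _) (d%:R * r / 2 * _) (d%:R / (2 * r)) => k1 k2 k3 k4.
  lra.
set A := [set x : 'cV[R]_d.+1 | _].
have mA : measurable (A : set B).
  have mY : measurable [set a : R | `|a - c| <= eta] by exact: measurable_slab.
  by apply: measurableI; [exact: coord_preimage_measurable mY | exact: measurable_sphere].
have := sphere_markov mA (fun x => @proj2 _ _) tH (fun x Sx => (HB x Sx).1)
  (fun x Ax => (HB x Ax.2).2 Ax.1).
rewrite IH => h.
have {}h : fine (mu A) <= 12 * eta * (1 + d%:R / r).
  rewrite (_ : 12 * eta * _ = 9 / 4 * (1 + d%:R / r) / (3 / (16 * eta))).
    by rewrite ler_pdivlMr ?divr_gt0 ?mulr_gt0// mulrC.
  by field; rewrite !gt_eqF.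
apply: le_trans h _.
rewrite (_ : 16 * eta * r = 12 * eta * (4 / 3 * r)); last by field.
rewrite ler_wpM2l ?mulr_ge0 ?(ltW eta0)//.
rewrite -(@ler_pM2r _ r)// mulrDl divfK ?gt_eqF// mul1r.
rewrite (_ : 4 / 3 * r * r = 4 / 3 * r ^+ 2); last by ring.
(* With d = r^2 - 1 the claim r + d <= (4/3) r^2 is r^2 - 3r + 3 >= 0. *)
have := sqr_ge0 (r - 3 / 2); rewrite sqrrB r2 NE; lra.
Qed.

Lemma slab_direction u c eta : (2 <= d)%N -> dot u u = 1 -> 0 < eta -> eta <= 1 / 16 ->
  (mu [set x : 'cV[R]_d.+1 | (`|dot u x - c| <= eta)%R] <=
   (16 * eta * Num.sqrt N)%:E)%E.
Proof.
move=> d2 uu eta0 eta1.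
wlog c0 : u c uu / 0 <= c => [hw|].
  have [/hw|c0] := leP 0 c; first exact.
  rewrite (_ : [set _ | _] = [set x | `|dot (- u) x - - c| <= eta]).
    by apply: hw; rewrite ?dotNl ?dotNr ?opprK// oppr_ge0 ltW.
  by apply/seteqP; split => x /=; rewrite dotNl -opprD normrN.
have mY : measurable [set a : R | `|a - c| <= eta] by exact: measurable_slab.
rewrite (direction_law uu mY) -measure_sphereI; last exact: coord_preimage_measurable.
have mA : measurable ([set x : 'cV[R]_d.+1 | `|x 0 0 - c| <= eta] `&` sphere : set B).
  by apply: measurableI; [exact: coord_preimage_measurable mY | exact: measurable_sphere].
rewrite -[leLHS]fineK ?lee_fin; first exact: slab_coord.
by rewrite ge0_fin_numE// (le_lt_trans (probability_le1 mu mA))// ltry.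
Qed.

End AntiConcentration.

(** * Measure of hyperplane sections *)

Section Hyperplanes.
Variables (R : realType) (d : nat).
Notation B := (borel_cV R d.+1).
Variable mu : probability B R.
Hypothesis mu_unif : uniform_sphere mu.
Local Notation sphere := (@sphere R d).
Local Notation I f := (\int[mu]_(x in sphere) f x)%R.

(** Suppose the section has mass [m] > 0. The Stein identity for a ramp at [c] bounds the mean of
    [H] by [d], while the section alone contributes (1 - c^2) m/eta, made equal to d + 1 by the
    choice of [eta]. *)
Lemma hyperplane_coord c : `|c| < 1 -> mu [set x : 'cV[R]_d.+1 | x 0 0 = c] = 0%E.
Proof.
move=> c1; have mc : measurable ([set x : 'cV[R]_d.+1 | x 0 0 = c] : set B).
  exact: (coord_preimage_measurable 0 (measurable_set1 c)).
rewrite -(measure_sphereI mu_unif mc).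
set A := _ `&` _; have mA : measurable A.
  by apply: measurableI => //; exact: measurable_sphere.
have finA : mu A \is a fin_num.
  by rewrite ge0_fin_numE// (le_lt_trans (probability_le1 mu mA))// ltry.
apply/eqP; rewrite -[mu A]fineK// eqe eq_le fine_ge0// andbT leNgt.
apply/negP; set m := fine _ => m0.
have c2 : 0 < 1 - c ^+ 2.
  rewrite subr_gt0 -real_normK ?num_real// -[ltRHS](expr1n _ 2).
  by rewrite ltrXn2r// nnegrE.
have D0 : 0 < d%:R + 1 :> R by rewrite ltr_wpDl.
pose eta := (1 - c ^+ 2) * m / (d%:R + 1).
have eta0 : 0 < eta by rewrite divr_gt0// mulr_gt0.
have GT := taylor1_ramp c eta0.
have cG : continuous (ramp c eta) by exact: ramp_continuous.
have cG1 : continuous (ramp1 c eta) by exact: ramp1_continuous.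
pose H (x : 'cV[R]_d.+1) := (1 - x 0 0 ^+ 2) * ramp1 c eta (x 0 0).
pose F (x : 'cV[R]_d.+1) := d%:R * x 0 0 * ramp c eta (x 0 0).
have tx2 : tame (fun x : 'cV[R]_d.+1 => x 0 0 ^+ 2) by exact: tame_sqr_coord.
have tH : tame H.
  apply: tame_mul; last exact: tame_G1 cG1 GT.
  by apply: tame_sub => //; exact: tame_cst.
have tF : tame F.
  apply: tame_mul; last exact: tame_G cG GT.
  by apply: tame_mul; [exact: tame_cst | exact: tame_coord].
have IFH : I F - I H = 0.
  by rewrite -(integralB_tame mu tF tH); exact: (stein_identity mu_unif cG cG1 GT).
have IF : I F <= d%:R.
  apply: le_trans (ler_norm _) _; apply: norm_integral_le => // x Sx.
  rewrite -[leRHS]mulr1; apply: normM_le; last exact: ltW (ramp_lt1 _ _ _).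
  by rewrite -[leRHS]mulr1; apply: normM_le; [rewrite ger0_norm | exact: coord_le1].
have x2 (x : 'cV[R]_d.+1) : sphere x -> 0 <= 1 - x 0 0 ^+ 2.
  move=> Sx; rewrite subr_ge0 -real_normK ?num_real// -[leRHS](expr1n _ 2).
  by rewrite lerXn2r ?nnegrE// coord_le1.
have H0 (x : 'cV[R]_d.+1) : sphere x -> 0 <= H x.
  by move=> Sx; rewrite mulr_ge0 ?x2//; case/andP: (ramp1_bounds c eta0 (x 0 0)).
have HA (x : 'cV[R]_d.+1) : A x -> (1 - c ^+ 2) / eta <= H x.
  by move=> [/= x0 _]; rewrite /H x0 /ramp1 subrr mul0r normr0 addr0 expr1n divr1.
have := sphere_markov mu mA (fun x => @proj2 _ _) tH H0 HA; rewrite -/m.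
rewrite (_ : (1 - c ^+ 2) / eta * m = d%:R + 1); last first.
  by rewrite /eta; field; rewrite !gt_eqF.
by move: IFH IF; lra.
Qed.

(** For |c| >= 1 a point of the sphere with first coordinate [c] has all others 0, hence lies in a
    null section of the last coordinate. *)
Lemma hyperplane_direction u c : (0 < d)%N -> dot u u = 1 ->
  mu [set x : 'cV[R]_d.+1 | dot u x = c] = 0%E.
Proof.
move=> d0 uu.
rewrite (direction_law mu_unif uu (measurable_set1 c)) /=.
have [c1|c1] := ltP `|c| 1; first exact: hyperplane_coord.
have mc a i : measurable ([set x : 'cV[R]_d.+1 | x i 0 = a] : set B).
  exact: (coord_preimage_measurable i (measurable_set1 a)).
pose i : 'I_d.+1 := ord_max.
have i0 : i != 0 by rewrite -val_eqE/= -lt0n.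
have mu0 : mu [set x : 'cV[R]_d.+1 | x i 0 = 0] = 0%E.
  have uq : dot (delta_mx i 0 : 'cV[R]_d.+1) (delta_mx i 0) = 1.
    by rewrite delta_dot mxE !eqxx.
  have := direction_law mu_unif uq (measurable_set1 0) => /=.
  rewrite (hyperplane_coord (c := 0)) ?normr0// => <-; congr (mu _).
  by apply/seteqP; split => x /=; rewrite delta_dot.
rewrite -(measure_sphereI mu_unif (mc c 0)).
apply/eqP; rewrite eq_le measure_ge0 andbT -mu0.
apply: le_measure; rewrite ?inE.
- by apply: measurableI => //; exact: measurable_sphere.
- exact: mc.
move=> x [/= x0 Sx]; apply/eqP; rewrite -sqrf_eq0 eq_le sqr_ge0 andbT.
have := Sx; rewrite /sphere/= dotE (bigD1 0)//= (bigD1 i)//= x0 -!expr2 => S1.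
have c2 : 1 <= c ^+ 2.
  by rewrite -real_normK ?num_real// exprn_ege1.
have : 0 <= \sum_(j < d.+1 | (j != 0) && (j != i)) x j 0 * x j 0.
  by apply: sumr_ge0 => j _; rewrite -expr2 sqr_ge0.
by move: S1 c2; lra.
Qed.

End Hyperplanes.

(** * The perturbed problem *)

(** The perturbation changes the objective by sigma <x, .>, at most sigma r in absolute value at
    each of the two points. *)
Lemma perturbed_gap (R : realType) d (A : 'M[R]_d) (b x s y : 'cV[R]_d) (sigma r : R) :
  0 <= sigma -> enorm x = 1 -> enorm s <= r -> enorm y <= r ->
  quad A b s - quad A b y <=
  quad A (b + sigma *: x) s - quad A (b + sigma *: x) y + 2 * sigma * r.
Proof.
move=> s0 x1 sr yr.
have xz z : enorm z <= r -> `|dot x z| <= r.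
  by move=> zr; rewrite (le_trans (dot_le_enorm _ _))// x1 mul1r.
have /andP[h1 _] : - r <= dot x s <= r by rewrite -ler_norml xz.
have /andP[_ h2] : - r <= dot x y <= r by rewrite -ler_norml xz.
rewrite !quadE !dot_lin -subr_ge0.
rewrite [leRHS](_ : _ = sigma * (dot x s - - r) + sigma * (r - dot x y)); last by ring.
by rewrite addr_ge0// mulr_ge0// subr_ge0.
Qed.

Lemma sphere_event (R : realType) d (mu : probability (borel_cV R d.+1) R)
    (A : set (borel_cV R d.+1)) (delta : R) :
  uniform_sphere mu -> measurable A -> (mu A <= delta%:E)%E ->
  ((1 - delta)%:E <= mu (@sphere R d `\` A))%E.
Proof.
move=> mu_unif mA Ad; have mS := @measurable_sphere R d.
rewrite measureD//; last by rewrite (le_lt_trans (probability_le1 mu mS))// ltry.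
rewrite [X in (_ <= X - _)%E](_ : _ = 1%E); last exact: mu_sphere.
rewrite EFinB; apply: leeB => //; apply: le_trans Ad.
by apply: le_measure; rewrite ?inE//; exact: measurableI.
Qed.

(** * Deterministic bounds with the constants of the theorem *)

Section Main.
Variables (R : realType) (d : nat) (A : 'M[R]_d.+1) (bt : 'cV[R]_d.+1).
Variables (r sigma delta : R) (t : nat) (s y : 'cV[R]_d.+1).
Hypotheses (As : A^T = A) (r0 : 0 < r) (sigma0 : 0 < sigma) (delta0 : 0 < delta).
Hypothesis smin :
  is_argmin [set x | x \in krylov A bt t.+1 /\ enorm x <= r] (quad A bt) s.
Hypothesis yr : enorm y <= r.

Let D := lambda_max A - lambda_min A.
Let T : R := t.+1%:R - 2^-1.

Let yr2 : dot y y <= r ^+ 2.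
Proof. by rewrite -enorm_le// ltW. Qed.

Let T_gt0 : 2^-1 <= T.
Proof.
rewrite /T (_ : t.+1%:R = t%:R + 1); last by rewrite natr1.
by have : 0 <= t%:R :> R by []; lra.
Qed.

Let Q_ge0 : 0 <= D * r ^+ 2 / T ^+ 2.
Proof. by rewrite divr_ge0 ?sqr_ge0// mulr_ge0 ?sqr_ge0//; exact: spread_ge0. Qed.

Let accelerated_rate : 2 * D * r ^+ 2 / t.+2%:R ^+ 2 <= D * r ^+ 2 / T ^+ 2 * 4.
Proof.
have D0 := spread_ge0 As.
rewrite [leRHS](_ : _ = 4 * D * r ^+ 2 / T ^+ 2); last by ring.
have T0 : 0 < T by apply: lt_le_trans T_gt0.
have tT : T <= t.+2%:R.
  have : t.+2%:R = t.+1%:R + 1 :> R by rewrite natr1.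
  by rewrite /T; lra.
apply: ler_pM; rewrite ?invr_ge0 ?exprn_ge0//.
- by rewrite mulr_ge0 ?sqr_ge0// mulr_ge0.
- by rewrite ler_wpM2r ?sqr_ge0// ler_wpM2r//; lra.
- by rewrite lef_pV2 ?posrE ?exprn_gt0// lerXn2r ?nnegrE// ltW.
Qed.

Let L := ln (2 * enorm bt * Num.sqrt d.+1%:R / (sigma * delta)).

(** The bound is infinite if [lambda_min A < 0] and [bt = 0], and [gap_convex] settles
    [lambda_min A >= 0]; only the premise's case remains. *)
Lemma error_boundP :
  (lambda_min A < 0 -> bt != 0 -> quad A bt s - quad A bt y <=
    D * r ^+ 2 / T ^+ 2 * (4 + 1 / 2 * L ^+ 2)) ->
  ((quad A bt s - quad A bt y + 2 * sigma * r)%:E <=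
    error_bound A bt r sigma delta t.+1)%E.
Proof.
move=> neg; rewrite /error_bound; case: ifPn => [_|]; first exact: leey.
rewrite negb_and; have [lo0 /= bt0|lo0 _] := ltP (lambda_min A) 0.
  by rewrite lee_fin lerD2r; exact: neg.
rewrite lee_fin lerD2r mul0r mul0r addr0.
exact: le_trans (gap_convex As r0 smin lo0 yr2) accelerated_rate.
Qed.

Hypothesis lo0 : lambda_min A < 0.
Variable u : 'cV[R]_d.+1.
Hypotheses (uu : dot u u = 1) (Au : A *m u = lambda_min A *: u).

Let weaken g : g <= D * r ^+ 2 / T ^+ 2 * 4 ->
  g <= D * r ^+ 2 / T ^+ 2 * (4 + 1 / 2 * L ^+ 2).
Proof.
move=> h; apply: le_trans h _; rewrite ler_wpM2l// lerDl.
by rewrite mulr_ge0// sqr_ge0.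
Qed.

Lemma low_dim_gap : bt != 0 -> (t == 0)%N || (d <= 1)%N && ((d == 1)%N ==> (dot u bt != 0)) ->
  quad A bt s - quad A bt y <= D * r ^+ 2 / T ^+ 2 * (4 + 1 / 2 * L ^+ 2).
Proof.
move=> bt0 small; apply: weaken; have [t0|t0] := posnP t.
  apply: le_trans (gap_one_step As r0 lo0 smin yr2 bt0 t0) _.
  rewrite /T t0 -/D -mulrA ler_peMr//.
    by rewrite mulr_ge0 ?sqr_ge0//; exact: spread_ge0.
  by rewrite (_ : _ * 4 = 16) //; [lra | field].
move: small; rewrite eqn0Ngt t0/= => /andP[d1 /implyP d1u].
exact: le_trans (gap_small_dim As r0 lo0 uu Au smin yr2 bt0 t0 d1 d1u) accelerated_rate.
Qed.

(** The assumed overlap gives 2|bt| <= 16 X |<u, bt>|, so the Lanczos estimate runs with l = ln(16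
    X), nonnegative by Cauchy-Schwarz. *)
Lemma high_dim_gap :
  delta / (16 * Num.sqrt d.+1%:R) * sigma < `|dot u bt| ->
  quad A bt s - quad A bt y <= D * r ^+ 2 / T ^+ 2 * (4 + 1 / 2 * L ^+ 2).
Proof.
set N := Num.sqrt _ => ub.
have N0 : 0 < N by rewrite sqrtr_gt0.
have m0 : 0 < delta / (16 * N) * sigma by rewrite mulr_gt0// divr_gt0// mulr_gt0.
have ub0 : 0 < `|dot u bt| := lt_trans m0 ub.
have ubn0 : dot u bt != 0 by rewrite -normr_gt0.
have u1 : enorm u = 1 by rewrite enorm_sqrt uu sqrtr1.
have ub1 : `|dot u bt| <= enorm bt by have := dot_le_enorm u bt; rewrite u1 mul1r.
pose X := 2 * enorm bt * N / (sigma * delta).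
have X0 : 0 < X.
  by rewrite divr_gt0 ?mulr_gt0// (lt_le_trans ub0).
have bX : 2 * enorm bt <= 16 * X * `|dot u bt|.
  rewrite (_ : 2 * enorm bt = 16 * X * (delta / (16 * N) * sigma)).
    by rewrite ler_wpM2l ?(ltW ub)// mulr_ge0// ltW.
  by rewrite /X; field; rewrite !gt_eqF.
have X1 : 1 <= 16 * X.
  rewrite -(ler_pM2r ub0) mul1r; apply: le_trans bX.
  by have := enorm_ge0 bt; lra.
have [l0 l1] := log_factor_le X0 X1.
apply: le_trans (gap_log As r0 lo0 uu Au smin yr2 ubn0 l0 _) _.
  rewrite [2 * ln _]mulrC expRM_natr lnK ?posrE ?(lt_le_trans ltr01)//.
  rewrite -enorm_sqr -[dot u bt ^+ 2]real_normK ?num_real// -exprMn.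
  rewrite (_ : 4 * _ = (2 * enorm bt) ^+ 2); last by ring.
  have p1 : 0 <= 2 * enorm bt by rewrite mulr_ge0// enorm_ge0.
  by rewrite lerXn2r ?nnegrE ?p1 ?(le_trans p1).
by apply: ler_wpM2l; [exact: Q_ge0 | exact: l1].
Qed.

End Main.

Lemma corollary3_succ (R : realType) (d : nat) (A : 'M[R]_d.+1) (b : 'cV[R]_d.+1)
    (r : R) (xstar : 'cV[R]_d.+1)
    (disp : measure_display) (Omega : measurableType disp)
    (P : probability Omega R) (v : {RV P >-> borel_cV R d.+1})
    (sigma : R) (t : nat) (s : Omega -> 'cV[R]_d.+1) (delta : R) :
  A^T = A -> 0 < r -> enorm xstar <= r ->
  uniform_sphere (distribution P v) -> 0 < sigma ->
  let bt := fun w : Omega => b + sigma *: (v w : 'cV[R]_d.+1) in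
  (forall w : Omega,
     is_argmin [set x | x \in krylov A (bt w) t.+1 /\ enorm x <= r]
               (quad A (bt w)) (s w)) ->
  0 < delta ->
  exists E : set Omega,
    [/\ measurable E,
        ((1 - delta)%:E <= P E)%E
      & forall w, E w ->
          ((quad A b (s w) - quad A b xstar)%:E
             <= error_bound A (bt w) r sigma delta t.+1)%E].
Proof.
move=> As r0 xr v_unif sigma0 bt smin delta0.
have [delta1|delta1] := leP 1 delta.
  exists set0; split => //.
  by rewrite measure0 lee_fin subr_le0.
(* [Z] is the exceptional set of directions; its complement is cut with the sphere so that |v| = 1
   is available for [perturbed_gap]. *)
suff [Z [mZ PZ gap]] : exists Z : set (borel_cV R d.+1),
    [/\ measurable Z, (distribution P v Z <= delta%:E)%E &
    forall w, ~ Z (v w) -> lambda_min A < 0 -> bt w != 0 ->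
      quad A (bt w) (s w) - quad A (bt w) xstar <=
      (lambda_max A - lambda_min A) * r ^+ 2 / (t.+1%:R - 2^-1) ^+ 2 * (4 + 1 / 2 *
        ln (2 * enorm (bt w) * Num.sqrt d.+1%:R / (sigma * delta)) ^+ 2)].
  exists (v @^-1` (@sphere R d `\` Z)); split.
  - rewrite -[X in measurable X]setTI; apply: measurable_funPT => //.
    by apply: measurableD => //; exact: measurable_sphere.
  - exact: (sphere_event v_unif mZ PZ).
  - move=> w [/= vS nZ].
    have vw1 : enorm (v w) = 1 by rewrite enorm_sqrt vS sqrtr1.
    have sr := (smin w).1.2.
    apply: le_trans (error_boundP As r0 (smin w) xr (gap w nZ)).
    by rewrite lee_fin; apply: perturbed_gap => //; exact: ltW.
have empty : (distribution P v set0 <= delta%:E)%E by rewrite measure0 lee_fin ltW.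
have [lo0|lo0] := leP 0 (lambda_min A).
  by exists set0; split => // w _; rewrite ltNge lo0.
have [u uu Au] := (lambda_min_eigen As).1.
have ubtE w : dot u (bt w) = sigma * (dot u (v w) - (- dot u b / sigma)).
  by rewrite !dot_lin; field; rewrite gt_eqF.
(* A single step or dimension 1: no direction is excluded. *)
have [small|large] := boolP ((t == 0%N) || (d == 0%N)).
  exists set0; split => // w _ _ bt0.
  apply: (low_dim_gap sigma delta As r0 (smin w) xr lo0 uu Au bt0).
  case/orP: small => [->//|/eqP d0].
  have d1 : (d <= 1)%N by rewrite d0.
  have d1N : (d == 1)%N = false by rewrite d0.
  by rewrite d1 d1N orbT.
move: large; rewrite negb_or => /andP[t0 d0]; rewrite -lt0n in d0.
pose c := - dot u b / sigma.
have mpre (Y : set R) : measurable Y ->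
    measurable ([set x | Y (dot u x)] : set (borel_cV R d.+1)).
  move=> mY; have := continuous_borel (@dot_continuous R d.+1 u).
  by move=> /(_ measurableT Y mY); rewrite setTI.
(* Dimension 2: the null set where [u] is orthogonal to [bt] is excluded. *)
have [d1|d2] := leqP d 1.
  exists [set x | dot u x = c]; split.
  - exact: (mpre [set c] (measurable_set1 c)).
  - by rewrite (hyperplane_direction v_unif c d0 uu) lee_fin ltW.
  - move=> w uc _ bt0; apply: (low_dim_gap sigma delta As r0 (smin w) xr lo0 uu Au bt0).
    rewrite d1/=; apply/orP; right; apply/implyP => _.
    by rewrite ubtE mulf_eq0 (gt_eqF sigma0) subr_eq0; apply/eqP.
have N0 : 0 < Num.sqrt d.+1%:R :> R by rewrite sqrtr_gt0.
have N1 : 1 <= Num.sqrt d.+1%:R :> R by rewrite -[leLHS]sqrtr1 ler_sqrt ?ltr0n// ler1n.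
(* Chosen so that the slab has measure at most [delta]; [delta < 1] keeps it below 1/16. *)
pose eta := delta / (16 * Num.sqrt d.+1%:R).
have eta0 : 0 < eta by rewrite divr_gt0// mulr_gt0.
have eta1 : eta <= 1 / 16.
  by rewrite ler_pdivrMr ?mulr_gt0//; lra.
exists [set x | `|dot u x - c| <= eta]; split.
- have mY : measurable [set a : R | `|a - c| <= eta] by exact: measurable_slab.
  exact: mpre _ mY.
- apply: le_trans (slab_direction v_unif c d2 uu eta0 eta1) _.
  by rewrite lee_fin le_eqVlt; apply/orP; left; apply/eqP; rewrite /eta; field; rewrite gt_eqF.
- move=> w /negP; rewrite -ltNge => uc _ bt0.
  apply: (high_dim_gap As r0 sigma0 delta0 (smin w) xr lo0 uu Au).
  by rewrite ubtE normrM gtr0_norm// mulrC ltr_pM2l.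
Qed.

Theorem corollary3 (R : realType) (d : nat) (A : 'M[R]_d) (b : 'cV[R]_d)
    (r : R) (xstar : 'cV[R]_d)
    (disp : measure_display) (Omega : measurableType disp)
    (P : probability Omega R) (v : {RV P >-> borel_cV R d})
    (sigma : R) (t : nat) (s : Omega -> 'cV[R]_d) (delta : R) :
  (0 < d)%N ->
  A^T = A ->
  0 < r ->
  is_argmin (eball r) (quad A b) xstar ->
  uniform_sphere (distribution P v) ->
  0 < sigma ->
  (0 < t)%N ->
  let bt := fun w : Omega => b + sigma *: (v w : 'cV[R]_d) in
  (forall w : Omega,
     is_argmin [set x | x \in krylov A (bt w) t /\ enorm x <= r]
               (quad A (bt w)) (s w)) ->
  0 < delta ->
  exists E : set Omega,
    [/\ measurable E,
        ((1 - delta)%:E <= P E)%E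
      & forall w, E w ->
          ((quad A b (s w) - quad A b xstar)%:E
             <= error_bound A (bt w) r sigma delta t)%E].
Proof.
case: d A b xstar v s => // d A b xstar v s _ As r0 [xr _] v_unif sigma0.
case: t => // t _ bt smin delta0.
exact: corollary3_succ.
Qed.
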